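(* Let $\mathbf{X}=(X,d,D,\alpha)$ be a computable metric space that has recognizable Boolean inclusions. Then there is a universal randomness test over $\mathbf{X}$, i.e. a randomness test $\mathbf{t}_\mu(x)$ such that for every randomness test $f_\mu(x)$ there is a constant $c_f>0$ with $c_f f_\mu(x)\le \mathbf{t}_\mu(x)$ for all $\mu\in\mathcal{M}(\mathbf{X})$ and $x\in X$.
   Context: A computable metric space is a tuple $(X,d,D,\alpha)$ where $(X,d)$ is a complete separable metric space, $D$ a countable dense subset enumerated by $\alpha$, and $(v,w)\mapsto d(\alpha(v),\alpha(w))$ computable. The balls $B(u,r)$, $u\in D$, $r>0$ rational, form an enumerated basis $U_1,U_2,\dots$. The space has recognizable Boolean inclusions if the set of pairs $(S,T)$ of finite sets of indices with $\bigcap_{i\in S}U_i\subseteq\bigcup_{j\in T}U_j$ is recursively enumerable. $\mathcal{M}(\mathbf{X})$ is the space of Borel probability measures on $X$ with the weak topology, regarded as a computable metric space via the Prokhorov distance $p(\mu,\nu)=\inf\{\varepsilon:\mu(A)\le\nu(A^\varepsilon)+\varepsilon\ \forall A \text{ Borel}\}$ ($A^\varepsilon=\{x:d(x,A)<\varepsilon\}$) and the dense set of finitely supported measures on $D$ with rational weights. A function $g$ into $[0,\infty]$ on a product of such spaces is lower semicomputable if $\{(z,r):g(z)>r\}$ is r.e. open (a union of an r.e. family of products of basis elements and rational intervals). A randomness test is a lower semicomputable function $f:\mathcal{M}(\mathbf{X})\times X\to[0,\infty]$, $(\mu,x)\mapsto f_\mu(x)$, with $\int f_\mu\,d\mu\le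 1$ for every $\mu$. *)

(* Defs.v *)
From HB Require Import structures.
From mathcomp Require Import all_boot all_order all_algebra.
From mathcomp Require Import all_classical all_reals all_analysis.

Set Implicit Arguments.
Unset Strict Implicit.
Unset Printing Implicit Defensive.

Import Order.TTheory GRing.Theory Num.Theory.
Import numFieldNormedType.Exports.

Local Open Scope classical_set_scope.
Local Open Scope ring_scope.

(** Recursively enumerable sets of natural numbers *)

(* A bijection nat * nat <-> nat. It matches the coding of sequences in
   [CodeSeq]: [CodeSeq.code (x :: s) = (npair x (CodeSeq.code s)).+1]. *)
Definition npair (a b : nat) : nat := (2 ^ a * b.*2.+1).-1%N.
Definition nleft (n : nat) : nat := logn 2 n.+1.
Definition nright (n : nat) : nat := (n.+1 %/ 2 ^ logn 2 n.+1)./2%N.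

Lemma npairK (a b : nat) :
  nleft (npair a b) = a /\ nright (npair a b) = b.
Proof.
have e : (npair a b).+1 = (2 ^ a * b.*2.+1)%N.
  by rewrite prednK// muln_gt0 expn_gt0.
have l : nleft (npair a b) = a.
  rewrite /nleft e lognM ?expn_gt0// pfactorK// lognE/= dvdn2/= odd_double.
  by rewrite addn0.
split=> //; rewrite /nright -/(nleft _) l e mulKn ?expn_gt0//.
by rewrite -[(b.*2.+1)]/(1 + b.*2)%N (half_bit_double b true).
Qed.

Lemma nunpairK (n : nat) : npair (nleft n) (nright n) = n.
Proof.
rewrite /npair /nright /nleft.
set k := logn 2 n.+1; set q := (n.+1 %/ 2 ^ k)%N.
have nE : n.+1 = (2 ^ k * q)%N by rewrite mulnC divnK// pfactor_dvdnn.
have oq : odd q.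
  apply: contraT => eq; have : (2 ^ k.+1 %| n.+1)%N.
    by rewrite nE expnSr dvdn_pmul2l ?expn_gt0// dvdn2.
  by rewrite pfactor_dvdn// -/k ltnn.
have := odd_double_half q; rewrite oq add1n => ->; by rewrite -nE.
Qed.

(* Programs for the partial recursive functions of one argument, several
   arguments being packed with [npair]. *)
Inductive prcode : Type :=
  | PRzero | PRsucc | PRleft | PRright
  | PRpair of prcode & prcode
  | PRcomp of prcode & prcode
  | PRprec of prcode & prcode
  | PRmu of prcode.

(* [pr_eval c n m]: the computation of [c] on input [n] halts with output [m].
   On input <a, k>, [PRprec f g] is the function h with h(a, 0) = f(a) and
   h(a, k + 1) = g(<a, <k, h(a, k)>>). On input a, [PRmu f] is the least k
   such that f(<a, k>) = 0 and all earlier f(<a, i>) are defined. *)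
Fixpoint pr_eval (c : prcode) (n m : nat) : Prop :=
  match c with
  | PRzero => m = 0%N
  | PRsucc => m = n.+1
  | PRleft => m = nleft n
  | PRright => m = nright n
  | PRpair f g => exists u v, [/\ pr_eval f n u, pr_eval g n v & m = npair u v]
  | PRcomp f g => exists2 u, pr_eval g n u & pr_eval f u m
  | PRprec f g =>
      (fix prec (k r : nat) : Prop :=
         match k with
         | 0%N => pr_eval f (nleft n) r
         | k'.+1 => exists2 r', prec k' r' &
             pr_eval g (npair (nleft n) (npair k' r')) r
         end) (nright n) m
  | PRmu f => pr_eval f (npair n m) 0 /\
      forall i, (i < m)%N -> exists r, pr_eval f (npair n i) r.+1
  end.

Definition re (A : set nat) : Prop :=
  exists c : prcode, A = [set n | exists m, pr_eval c n m].

(** Rational numbers and computable reals *)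

(* Both enumerations are surjective, onto the rationals and the positive
   rationals respectively. *)
Definition ratcode (n : nat) : rat :=
  ((nleft (nleft n))%:R - (nright (nleft n))%:R) / (nright n).+1%:R.
Definition posratcode (n : nat) : rat := (nleft n).+1%:R / (nright n).+1%:R.

Definition computable_real2 (R : realType) (x : nat -> nat -> R) : Prop :=
  exists c : prcode, forall v w k : nat,
    exists2 m, pr_eval c (npair (npair v w) k) m &
      `|x v w - ratr (ratcode m)| <= 2 ^- k.

(** Computable metric spaces *)

#[short(type="completeMetricType")]
HB.structure Definition CompleteMetric (R : numDomainType) :=
  {T of Complete T & Metric R T & PseudoPointedMetric R T}.

(* The dense set D is the range of [alpha]. *)
Definition computable_metric_space (R : realType) (X : completeMetricType R)
    (alpha : nat -> X) : Prop :=
  dense (range alpha) /\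
  computable_real2 (fun v w => mdist (alpha v) (alpha w)).

Definition ball_basis (R : realType) (Y : Type) (dist : Y -> Y -> R)
    (alpha : nat -> Y) (i : nat) : set Y :=
  [set y | dist (alpha (nleft i)) y < ratr (posratcode (nright i))].

Definition finset_of_code (n : nat) : set nat :=
  [set i | i \in CodeSeq.decode n].

Definition recognizable_Boolean_inclusions (R : realType)
    (X : completeMetricType R) (alpha : nat -> X) : Prop :=
  let U := ball_basis mdist alpha in
  re [set n | \bigcap_(i in finset_of_code (nleft n)) U i `<=`
              \bigcup_(j in finset_of_code (nright n)) U j].

(** The space of Borel probability measures *)

Definition borelType (R : realType) (X : completeMetricType R) :=
  g_sigma_algebraType (@open X).

Section Mspace.
Variables (R : realType) (X : completeMetricType R).

Definition dist_set (x : X) (A : set X) : \bar R :=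
  ereal_inf [set (mdist x a)%:E | a in A].

Definition enlarge (A : set X) (e : R) : set X :=
  [set x | (dist_set x A < e%:E)%E].

Definition prokhorov (mu nu : probability (borelType X) R) : R :=
  inf [set e : R | 0 < e /\
    forall A : set (borelType X), measurable A ->
      (mu A <= nu (enlarge A e) + e%:E)%E].

(* The enumeration of the measures with finite support in the range of
   [alpha] and rational weights. An entry <v, w> of the sequence coded by [n]
   gives the point [alpha v] the integer weight w, and the total is normalized
   to 1. If all the weights are zero, the result is the Dirac measure at
   [alpha 0]. *)
Definition ratmeasure (alpha : nat -> X) (n : nat) :
    probability (borelType X) R :=
  let s := CodeSeq.decode n in
  mnormalize
    (msum (fun i => mscale (nright (nth 0%N s i))%:R%:nng
                      (@dirac _ (borelType X) (alpha (nleft (nth 0%N s i))) R))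
       (size s))
    (@dirac _ (borelType X) (alpha 0%N) R).

End Mspace.

(** Lower semicomputable functions and randomness tests *)

Definition rat_interval (R : realType) (k : nat) : set R :=
  [set r | ratr (ratcode (nleft k)) < r < ratr (ratcode (nright k))].

Definition lower_semicomputable (R : realType) (Y Z : Type)
    (U : nat -> set Y) (V : nat -> set Z) (g : Y -> Z -> \bar R) : Prop :=
  exists2 W : set nat, re W &
    [set p : Y * Z * R | (p.2%:E < g p.1.1 p.1.2)%E] =
    \bigcup_(n in W) (U (nleft (nleft n)) `*` V (nright (nleft n)) `*`
                      @rat_interval R (nright n)).

Definition randomness_test (R : realType) (X : completeMetricType R)
    (alpha : nat -> X) (f : probability (borelType X) R -> X -> \bar R) :
    Prop :=
  [/\ forall mu x, (0 <= f mu x)%E,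
      lower_semicomputable (ball_basis (@prokhorov R X) (ratmeasure alpha))
        (ball_basis mdist alpha) f
    & forall mu : probability (borelType X) R, (\int[mu]_x f mu x <= 1)%E].

(* Main.v *)
(** A lower semicomputable function is a supremum of functions that are
    constant on a product of two balls and zero elsewhere, so the programs
    enumerate all of them; up to an additive constant the values may be taken
    to be natural numbers. A program is trimmed to a test as follows. At stage
    [s] of the enumeration all radii are shrunk by [4 / (s + 1)]; this gives an
    increasing sequence of step functions. A stage is admissible at [mu] if
    [mu] is at distance less than [1 / (s + 1)] from a measure [m] with finite
    support and rational weights for which the integral of the step function,
    computed with slightly larger radii, is recognized to be at most [1]. As
    [m] has finitely many atoms, this is a semidecidable condition on [m]. The
    values at stage [s] are at most [s], so the layer cake formula bounds the
    integral of an admissible step function with respect to [mu] by [2]. The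
    admissible stages increase, so the integral of their supremum is at most
    [2] too. If the program enumerates a test, then every stage is admissible,
    because the test condition holds at [m], and the trimming changes nothing.
    The universal test is the supremum of the trimmed functions with weights
    that decrease geometrically. *)
Require Import Defs.
From HB Require Import structures.
From mathcomp Require Import all_boot all_order all_algebra.
From mathcomp Require Import all_classical all_reals all_analysis.
From mathcomp Require Import measurable_realfun lra ring zify.

Set Implicit Arguments.
Unset Strict Implicit.
Unset Printing Implicit Defensive.

Import Order.TTheory GRing.Theory Num.Theory.
Import numFieldNormedType.Exports.

Local Open Scope nat_scope.

Lemma npairKl a b : nleft (npair a b) = a.
Proof. by have [] := npairK a b. Qed.

Lemma npairKr a b : nright (npair a b) = b.
Proof. by have [] := npairK a b. Qed.

Definition npairKE := (npairKl, npairKr).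

(** * Computable functions *)

(* Functions and predicates of several variables are treated as functions of
   the packed variables. In particular a closure lemma that binds a variable
   [i] next to the argument [n] has premises about [z = npair n i]. *)
Definition computable (f : nat -> nat) : Prop :=
  exists c, forall n m, pr_eval c n m <-> m = f n.

Definition decidable_pred (P : nat -> bool) : Prop :=
  computable (fun n => nat_of_bool (P n)).

Create HintDb comp discriminated.
#[global] Hint Constants Opaque : comp.
Ltac comp := auto 50 with comp.

Lemma computable_ext f g : f =1 g -> computable f -> computable g.
Proof. by move=> /funext ->. Qed.

Lemma decidable_ext P Q : P =1 Q -> decidable_pred P -> decidable_pred Q.
Proof. by move=> /funext ->. Qed.

Lemma computable_id : computable (fun n => n).
Proof.
exists (PRpair PRleft PRright) => n m /=; split=> [[u [v [-> -> ->]]]|->].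
  exact: nunpairK.
by exists (nleft n), (nright n); rewrite nunpairK.
Qed.
#[global] Hint Resolve computable_id : comp.

Lemma computable_comp f g :
  computable f -> computable g -> computable (fun n => f (g n)).
Proof.
move=> [cf Hf] [cg Hg]; exists (PRcomp cf cg) => n m /=; split.
  by move=> [u /Hg -> /Hf].
by move=> ->; exists (g n); [apply/Hg|apply/Hf].
Qed.

(* As a plain hint, [computable_comp] would apply to every goal; here the outer function has to come
   from a hypothesis. *)
#[global] Hint Extern 1 (computable _) =>
  match goal with
  | H : computable ?f |- computable (fun z => ?f (@?g z)) =>
    apply (computable_comp H)
  end : comp.

Lemma computable_comp2 F f g :
  computable (fun z => F (nleft z) (nright z)) ->
  computable (fun n => npair (f n) (g n)) ->
  computable (fun n => F (f n) (g n)).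
Proof.
move=> CF Cfg; apply: computable_ext (computable_comp CF Cfg) => n.
by rewrite !npairKE.
Qed.
#[global] Hint Extern 1 (computable _) =>
  match goal with
  | H : computable (fun z => ?F (nleft z) (nright z)) |-
      computable (fun z => ?F (@?f z) (@?g z)) =>
    apply (computable_comp2 H)
  end : comp.

Lemma decidable_comp P g :
  decidable_pred P -> computable g -> decidable_pred (fun n => P (g n)).
Proof. exact: computable_comp. Qed.
#[global] Hint Extern 1 (decidable_pred _) =>
  match goal with
  | H : decidable_pred ?f |- decidable_pred (fun z => ?f (@?g z)) =>
    apply (decidable_comp H)
  end : comp.

Lemma computable_succ f : computable f -> computable (fun n => (f n).+1).
Proof. by apply: (@computable_comp S); exists PRsucc. Qed.

Lemma computable_nleft f : computable f -> computable (fun n => nleft (f n)).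
Proof. by apply: (@computable_comp nleft); exists PRleft. Qed.

Lemma computable_nright f : computable f -> computable (fun n => nright (f n)).
Proof. by apply: (@computable_comp nright); exists PRright. Qed.

Lemma computable_npair f g : computable f -> computable g ->
  computable (fun n => npair (f n) (g n)).
Proof.
move=> [cf Hf] [cg Hg]; exists (PRpair cf cg) => n m /=; split.
  by move=> [u [v [/Hf -> /Hg ->]]].
by move=> ->; exists (f n), (g n); split => //; [apply/Hf|apply/Hg].
Qed.
#[global] Hint Resolve computable_succ computable_nleft computable_nright
  computable_npair : comp.

Lemma computable_const c : computable (fun=> c).
Proof.
elim: c => [|c IH]; first by exists PRzero.
exact: computable_succ.
Qed.
#[global] Hint Resolve computable_const : comp.

(** This is [PRprec], whose step reads the packed argument, index and previous value. Most of the
    arithmetic below reduces to it. *)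
Lemma computable_iteri b f g :
  computable b -> computable f ->
  computable (fun z => g (nleft z) (nleft (nright z)) (nright (nright z))) ->
  computable (fun n => iteri (b n) (g n) (f n)).
Proof.
move=> Cb [cf Hf] [cg Hg].
pose h z := iteri (nright z) (g (nleft z)) (f (nleft z)).
suff Ch : computable h.
  apply: (@computable_ext (fun n => h (npair n (b n)))) => [n|].
    by rewrite /h !npairKE.
  by apply: computable_comp => //; comp.
exists (PRprec cf cg) => z m /=; rewrite /h.
elim: (nright z) m => [|k IH] m /=; first exact: Hf.
split=> [[r' /IH -> /Hg]|->]; first by rewrite !npairKE.
by exists (iteri k (g (nleft z)) (f (nleft z))); [apply/IH|apply/Hg;
  rewrite !npairKE].
Qed.
#[global] Hint Resolve computable_iteri : comp.

Lemma computable_addn f g : computable f -> computable g ->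
  computable (fun n => f n + g n).
Proof.
move=> Cf Cg.
apply: (@computable_ext (fun n => iteri (f n) (fun _ r => r.+1) (g n))).
  by move=> n; elim: (f n) => //= k ->.
by comp.
Qed.
#[global] Hint Resolve computable_addn : comp.

Lemma computable_muln f g : computable f -> computable g ->
  computable (fun n => f n * g n).
Proof.
move=> Cf Cg.
apply: (@computable_ext (fun n => iteri (f n)
    (fun _ r => r + g n) 0)).
  by move=> n; elim: (f n) => //= k ->; rewrite mulSn addnC.
by comp.
Qed.
#[global] Hint Resolve computable_muln : comp.

Lemma computable_predn f : computable f -> computable (fun n => (f n).-1).
Proof.
move=> Cf; apply: (@computable_ext (fun n => iteri (f n) (fun k _ => k) 0)).
  by move=> n; case: (f n).
by comp.
Qed.
#[global] Hint Resolve computable_predn : comp.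

Lemma computable_subn f g : computable f -> computable g ->
  computable (fun n => f n - g n).
Proof.
move=> Cf Cg.
apply: (@computable_ext (fun n => iteri (g n) (fun _ r => r.-1) (f n))).
  by move=> n; elim: (g n) => [|k IH] /=; rewrite ?subn0// subnS IH.
by comp.
Qed.
#[global] Hint Resolve computable_subn : comp.

Lemma computable_expn f g : computable f -> computable g ->
  computable (fun n => f n ^ g n).
Proof.
move=> Cf Cg.
apply: (@computable_ext (fun n => iteri (g n) (fun _ r => f n * r) 1)).
  by move=> n; elim: (g n) => [|k IH] //=; rewrite expnS IH.
by comp.
Qed.
#[global] Hint Resolve computable_expn : comp.

Lemma computable_nat_of_bool P :
  decidable_pred P -> computable (fun n => nat_of_bool (P n)).
Proof. by []. Qed.
#[global] Hint Resolve computable_nat_of_bool : comp.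

Lemma decidable_negb P : decidable_pred P -> decidable_pred (fun n => ~~ P n).
Proof.
move=> DP; apply: (@computable_ext (fun n => 1 - P n)) => [n|].
  by case: (P n).
by comp.
Qed.

Lemma decidable_andb P Q : decidable_pred P -> decidable_pred Q ->
  decidable_pred (fun n => P n && Q n).
Proof.
move=> DP DQ; apply: (@computable_ext (fun n => P n * Q n)) => [n|].
  by rewrite mulnb.
by comp.
Qed.
#[global] Hint Resolve decidable_negb decidable_andb : comp.

Lemma decidable_orb P Q : decidable_pred P -> decidable_pred Q ->
  decidable_pred (fun n => P n || Q n).
Proof.
move=> DP DQ; apply: (@decidable_ext (fun n => ~~ (~~ P n && ~~ Q n))) => [n|].
  by rewrite negb_and !negbK.
by comp.
Qed.
#[global] Hint Resolve decidable_orb : comp.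

Lemma decidable_leq f g : computable f -> computable g ->
  decidable_pred (fun n => f n <= g n).
Proof.
move=> Cf Cg; apply: (@computable_ext (fun n => 1 - (f n - g n))) => [n|].
  by rewrite leqNgt -subn_gt0; case: (f n - g n).
by comp.
Qed.
#[global] Hint Resolve decidable_leq : comp.

Lemma decidable_eqn f g : computable f -> computable g ->
  decidable_pred (fun n => f n == g n).
Proof.
move=> Cf Cg; apply: (@decidable_ext (fun n => (f n <= g n) && (g n <= f n))).
  by move=> n; rewrite eqn_leq.
by comp.
Qed.
#[global] Hint Resolve decidable_eqn : comp.

Lemma computable_sum b F : computable b ->
  computable (fun z => F (nleft z) (nright z)) ->
  computable (fun n => \sum_(0 <= i < b n) F n i).
Proof.
move=> Cb CF.
apply: (@computable_ext (fun n => iteri (b n) (fun k r => r + F n k) 0)).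
  move=> n; elim: (b n) => [|k IH] /=; first by rewrite big_nil.
  by rewrite big_nat_recr//= IH.
apply: computable_iteri; [by comp..|].
by comp.
Qed.
#[global] Hint Resolve computable_sum : comp.

Lemma decidable_all b (P : nat -> nat -> bool) : computable b ->
  decidable_pred (fun z => P (nleft z) (nright z)) ->
  decidable_pred (fun n => all (P n) (iota 0 (b n))).
Proof.
move=> Cb DP.
apply: (@decidable_ext (fun n =>
  \sum_(0 <= i < b n) nat_of_bool (~~ P n i) == 0)).
  move=> n; rewrite big_mkord sum_nat_eq0; apply/forallP/allP => [H i|H i].
    by rewrite mem_iota /= add0n => ib; have := H (Ordinal ib); case: (P n i).
  by rewrite H// mem_iota /= add0n.
by comp.
Qed.

Lemma decidable_has b (P : nat -> nat -> bool) : computable b ->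
  decidable_pred (fun z => P (nleft z) (nright z)) ->
  decidable_pred (fun n => has (P n) (iota 0 (b n))).
Proof.
move=> Cb DP.
apply: (@decidable_ext (fun n => ~~ all (fun i => ~~ P n i) (iota 0 (b n)))).
  by move=> n; rewrite -has_predC; apply: eq_has => i /=; rewrite negbK.
by apply/decidable_negb/decidable_all; comp.
Qed.
#[global] Hint Resolve decidable_all decidable_has : comp.

Lemma decidable_odd f : computable f -> decidable_pred (fun n => odd (f n)).
Proof.
move=> Cf.
apply: (@computable_ext (fun n => iteri (f n) (fun _ r => 1 - r) 0)) => [n|].
  by elim: (f n) => //= k ->; case: odd.
by comp.
Qed.
#[global] Hint Resolve decidable_odd : comp.

Lemma computable_half f : computable f -> computable (fun n => (f n)./2).
Proof.
move=> Cf; apply: (@computable_ext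
    (fun n => iteri (f n) (fun k r => nat_of_bool (odd k) + r) 0)) => [n|].
  by elim: (f n) => //= k ->; rewrite uphalf_half.
by comp.
Qed.
#[global] Hint Resolve computable_half : comp.

(** * Binary digits and codes of finite sequences *)

Definition bit (A i : nat) : bool := odd (iteri i (fun=> half) A).

Lemma decidable_bit f g : computable f -> computable g ->
  decidable_pred (fun n => bit (f n) (g n)).
Proof. by move=> Cf Cg; rewrite /bit; comp. Qed.
#[global] Hint Resolve decidable_bit : comp.

(** The bound on [A] turns a quantifier over subsets of a finite set into a bounded numerical one,
    which keeps [prokhorov_below] semidecidable. *)
Lemma bit_surj (P : nat -> bool) N :
  exists2 A, A < 2 ^ N & forall i, i < N -> bit A i = P i.
Proof.
have E A i : bit A i.+1 = bit A./2 i.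
  rewrite /bit; congr odd; elim: i => [|i IH] //.
  by rewrite [LHS]/= -[half _]/(half (iteri i.+1 (fun=> half) A)) IH.
elim: N P => [|N IH] P; first by exists 0.
have [A AN HA] := IH (fun i => P i.+1).
exists (P 0 + A.*2) => [|[|i] iN]; last by rewrite E half_bit_double HA.
  rewrite expnS mul2n; apply: (@leq_trans (A.*2.+2));
    last by rewrite -doubleS leq_double.
  by rewrite !ltnS; case: (P 0); rewrite ?add1n ?add0n.
by rewrite /bit /= oddD odd_double addbF; case: (P 0).
Qed.

(** The code [0] of the empty sequence is a fixed point because [nright 0 = 0], so [codenth] yields
    [0] past the end. *)
Definition codetail (n : nat) : nat := nright n.-1.

Lemma code_cons x s : CodeSeq.code (x :: s) = (npair x (CodeSeq.code s)).+1.
Proof. by rewrite /npair prednK// muln_gt0 expn_gt0. Qed.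

Lemma codetailE n : CodeSeq.decode (codetail n) = behead (CodeSeq.decode n).
Proof.
rewrite -[n]CodeSeq.decodeK; case: (CodeSeq.decode n) => [//|x s].
by rewrite CodeSeq.codeK code_cons /codetail succnK npairKE CodeSeq.codeK.
Qed.

Definition codenth (n i : nat) : nat := nleft (iteri i (fun=> codetail) n).-1.

Lemma codenthE n i : codenth n i = nth 0 (CodeSeq.decode n) i.
Proof.
rewrite /codenth -{2}[i]addn0 -nth_drop.
have <- : CodeSeq.decode (iteri i (fun=> codetail) n) =
    drop i (CodeSeq.decode n).
  elim: i => [|i IH]; first by rewrite drop0.
  by rewrite [iteri _ _ _]/= codetailE IH -drop1 drop_drop add1n.
rewrite -[in LHS](CodeSeq.decodeK (iteri i _ n)).
case: (CodeSeq.decode _) => [//|x s].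
by rewrite code_cons succnK npairKE.
Qed.

Lemma computable_codenth f g : computable f -> computable g ->
  computable (fun n => codenth (f n) (g n)).
Proof. by move=> Cf Cg; rewrite /codenth /codetail; comp. Qed.
#[global] Hint Resolve computable_codenth : comp.

(** Sums over a coded sequence may thus run up to the code itself, the surplus entries being [0]. *)
Lemma size_decode n : size (CodeSeq.decode n) <= n.
Proof.
rewrite -{2}[n]CodeSeq.decodeK; elim: (CodeSeq.decode n) => //= x s IH.
rewrite (leq_ltn_trans IH)// -[ltnLHS]mul1n.
apply: (@leq_trans (1 * (CodeSeq.code s).*2.+1)).
  by rewrite !mul1n ltnS -addnn leq_addr.
by rewrite leq_mul2r expn_gt0 orbT.
Qed.

Lemma codenth_default n i : n <= i -> codenth n i = 0.
Proof.
by move=> ni; rewrite codenthE nth_default// (leq_trans (size_decode n)).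
Qed.

(** * Semidecidable predicates *)

Definition semidecidable (P : nat -> Prop) : Prop :=
  exists2 D, decidable_pred D & forall n, P n <-> exists k, D (npair n k).

Lemma semidecidable_ext P Q : (forall n, P n <-> Q n) ->
  semidecidable P -> semidecidable Q.
Proof. by move=> PQ; have -> : P = Q by apply/funext => n; apply/propext. Qed.

Lemma semidecidable_decidable P :
  decidable_pred P -> semidecidable (fun n => P n).
Proof.
move=> DP; exists (fun z => P (nleft z)) => [|n]; first by comp.
by split=> [|[k]]; [exists 0|]; rewrite ?npairKE.
Qed.
#[global] Hint Resolve semidecidable_decidable : comp.

Lemma semidecidable_eq f g : computable f -> computable g ->
  semidecidable (fun n => f n = g n).
Proof.
move=> Cf Cg; apply: (@semidecidable_ext (fun n => f n == g n)).
  by move=> n; split => /eqP.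
by comp.
Qed.
#[global] Hint Resolve semidecidable_eq : comp.

Lemma semidecidable_comp P f : semidecidable P -> computable f ->
  semidecidable (fun n => P (f n)).
Proof.
move=> [D DD HD] Cf; exists (fun z => D (npair (f (nleft z)) (nright z))).
  by comp.
by move=> n; rewrite HD; split=> -[k Hk]; exists k; move: Hk; rewrite !npairKE.
Qed.

Lemma semidecidable_comp3 P f g h :
  semidecidable (fun z => P (nleft z) (nleft (nright z)) (nright (nright z))) ->
  computable (fun n => npair (f n) (npair (g n) (h n))) ->
  semidecidable (fun n => P (f n) (g n) (h n)).
Proof.
move=> SP Cfg; apply: semidecidable_ext (semidecidable_comp SP Cfg) => n.
by rewrite !npairKE.
Qed.

Lemma semidecidable_exists P : semidecidable (fun z =>
  P (nleft z) (nright z)) ->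
  semidecidable (fun n => exists i, P n i).
Proof.
move=> [D DD HD].
exists (fun z => D (npair (npair (nleft z) (nleft (nright z)))
                          (nright (nright z)))).
  by comp.
move=> n; split=> [[i Pni]|[k]].
  have /HD[k Dk] : P (nleft (npair n i)) (nright (npair n i)).
    by rewrite !npairKE.
  by exists (npair i k); rewrite !npairKE.
rewrite !npairKE => Dk; exists (nleft k).
have : P (nleft (npair n (nleft k))) (nright (npair n (nleft k))).
  by apply/HD; exists (nright k).
by rewrite !npairKE.
Qed.

Lemma semidecidable_and P Q : semidecidable P -> semidecidable Q ->
  semidecidable (fun n => P n /\ Q n).
Proof.
move=> [D DD HD] [E DE HE].
apply: (@semidecidable_ext (fun n => exists k, exists l,
    D (npair n k) && E (npair n l))) => [n|].
  split=> [[k [l /andP[Dk El]]]|[/HD[k Dk] /HE[l El]]].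
    by split; [apply/HD; exists k|apply/HE; exists l].
  by exists k, l; rewrite Dk.
by do 2![apply: semidecidable_exists]; comp.
Qed.

Lemma semidecidable_or P Q : semidecidable P -> semidecidable Q ->
  semidecidable (fun n => P n \/ Q n).
Proof.
move=> [D DD HD] [E DE HE].
apply: (@semidecidable_ext (fun n => exists k,
    D (npair n k) || E (npair n k))) => [n|].
  split=> [[k /orP[Dk|Ek]]|[/HD[k Dk]|/HE[k Ek]]].
  - by left; apply/HD; exists k.
  - by right; apply/HE; exists k.
  - by exists k; rewrite Dk.
  - by exists k; rewrite Ek orbT.
by apply: semidecidable_exists; comp.
Qed.

(** Finitely many searches share one bound [K] above all their witnesses. *)
Lemma semidecidable_forall_lt b P : computable b ->
  semidecidable (fun z => P (nleft z) (nright z)) ->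
  semidecidable (fun n => forall i, i < b n -> P n i).
Proof.
move=> Cb [D DD HD].
apply: (@semidecidable_ext (fun n => exists K,
    all (fun i => has (fun k => D (npair (npair n i) k)) (iota 0 K))
        (iota 0 (b n)))) => [n|].
  split=> [[K /allP HK] i ib|H].
    have /HK/hasP[k _ Dk] : i \in iota 0 (b n) by rewrite mem_iota.
    have : P (nleft (npair n i)) (nright (npair n i)) by apply/HD; exists k.
    by rewrite !npairKE.
  elim: (b n) H => [|m IH] H; first by exists 0.
  have [i im|K /allP HK] := IH; first exact/H/ltnW.
  have /HD[k Dk] : P (nleft (npair n m)) (nright (npair n m)).
    by rewrite !npairKE; exact: H.
  exists (maxn K k.+1); apply/allP => i; rewrite mem_iota /= add0n ltnS.
  rewrite leq_eqVlt => /predU1P[->|im].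
    by apply/hasP; exists k => //; rewrite mem_iota /= add0n leq_max ltnSn orbT.
  have /HK/hasP[l] : i \in iota 0 m by rewrite mem_iota.
  rewrite mem_iota /= add0n => lK Dl; apply/hasP; exists l => //.
  by rewrite mem_iota /= add0n leq_max lK.
apply: semidecidable_exists; comp.
Qed.
#[global] Hint Resolve semidecidable_exists semidecidable_and semidecidable_or
  semidecidable_forall_lt : comp.

Lemma semidecidable_if b P Q :
  decidable_pred b -> semidecidable P -> semidecidable Q ->
  semidecidable (fun n => if b n then P n else Q n).
Proof.
move=> Db SP SQ.
apply: (@semidecidable_ext (fun n => (b n /\ P n) \/ (~~ b n /\ Q n))).
  by move=> n; case: (b n) => /=; intuition.
by comp.
Qed.
#[global] Hint Resolve semidecidable_if : comp.

(** [PRmu] searches for a zero, hence the negation of [D]. *)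
Lemma re_semidecidable P : semidecidable P -> re [set n | P n].
Proof.
move=> [D DD HD].
have [c Hc] : computable (fun z => nat_of_bool (~~ D z)) by comp.
exists (PRmu c); apply/seteqP; split=> n /= => [/HD Dn|[m [/Hc e _]]].
  exists (ex_minn Dn); case: ex_minnP => m Dm min_m; split.
    by apply/Hc; rewrite Dm.
  move=> i im; exists 0; apply/Hc; case: (boolP (D _)) => // /min_m.
  by rewrite leqNgt im.
by apply/HD; exists m; move: e; case: (D _).
Qed.

(** * A universal program *)

Fixpoint prnum (c : prcode) : nat :=
  match c with
  | PRzero => npair 0 0
  | PRsucc => npair 1 0
  | PRleft => npair 2 0
  | PRright => npair 3 0
  | PRpair f g => npair 4 (npair (prnum f) (prnum g))
  | PRcomp f g => npair 5 (npair (prnum f) (prnum g))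
  | PRprec f g => npair 6 (npair (prnum f) (prnum g))
  | PRmu f => npair 7 (prnum f)
  end.

(* One step of a computation, the results of the subcomputations being taken
   from the set S of triples (program, input, output). *)
Definition justified (S : nat -> nat -> nat -> Prop) (e n m : nat) : Prop :=
  if nleft e == 0 then m = 0 else
  if nleft e == 1 then m = n.+1 else
  if nleft e == 2 then m = nleft n else
  if nleft e == 3 then m = nright n else
  if nleft e == 4 then exists u, exists v, S (nleft (nright e)) n u /\
    S (nright (nright e)) n v /\ m = npair u v else
  if nleft e == 5 then
    exists u, S (nright (nright e)) n u /\ S (nleft (nright e)) u m else
  if nleft e == 6 then
    if nright n == 0 then S (nleft (nright e)) (nleft n) m else
    exists r, S e (npair (nleft n) (nright n).-1) r /\
      S (nright (nright e)) (npair (nleft n) (npair (nright n).-1 r)) m else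
  S (nright e) (npair n m) 0 /\
  forall i, i < m -> exists r, S (nright e) (npair n i) r.+1.

Lemma justified_sub (S T : nat -> nat -> nat -> Prop) e n m :
  (forall e n m, S e n m -> T e n m) -> justified S e n m -> justified T e n m.
Proof.
move=> ST; rewrite /justified.
do 4 (case: ifP => // _).
case: ifP => _; first by move=> [u [v [? []]]]; exists u, v; auto.
case: ifP => _; first by move=> [u []]; exists u; auto.
case: ifP => _.
  by case: ifP => _; [exact: ST|move=> [r []]; exists r; auto].
by move=> [? H]; split; [exact: ST|move=> i /H[r /ST]; exists r].
Qed.

(** A table of results justified within the table. Instead of ordering the entries, soundness uses
    that calls decrease for numbers of programs. *)
Definition closed_computation (S : nat -> nat -> nat -> Prop) : Prop :=
  forall e n m, S e n m -> justified S e n m.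

(* The programs get smaller along justifications, except for the calls of a
   primitive recursion to itself, where the recursion argument does. *)
Lemma closed_computation_sound S c n m : closed_computation S ->
  S (prnum c) n m -> pr_eval c n m.
Proof.
move=> CS; elim: c n m =>
  [| | | |f IHf g IHg|f IHf g IHg|f IHf g IHg|f IHf] n m.
1-4: by move=> /CS; rewrite /justified !npairKE.
- move=> /CS; rewrite /justified !npairKE /=.
  by move=> [u [v [/IHf ? [/IHg ? ->]]]]; exists u, v.
- by move=> /CS; rewrite /justified !npairKE /= => -[u [/IHg ? /IHf ?]];
  exists u.
- rewrite [pr_eval _ _ _]/= -{1}(nunpairK n).
  move: (nleft n) (nright n) => a k.
  elim: k m => [|k IH] m /CS; rewrite /justified !npairKE /=; first exact: IHf.
  by move=> [r [/IH ? /IHg ?]]; exists r.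
- move=> /CS; rewrite /justified !npairKE /= => -[? H].
  by split; [exact: IHf|move=> i /H[r /IHf ?]; exists r].
Qed.

(** The successor separates genuine entries from the default [0] of [codenth]. *)
Definition in_code (L e n m : nat) : Prop :=
  exists i, codenth L i = (npair e (npair n m)).+1.

(** A finite closed table certifies the computation. Positions below [L] exhaust it, as the sequence
    coded by [L] has length at most [L]. *)
Definition univ (e n m : nat) : Prop :=
  exists L, in_code L e n m /\
    forall i, i < L -> codenth L i = 0 \/
      justified (in_code L) (nleft (codenth L i).-1)
        (nleft (nright (codenth L i).-1)) (nright (nright (codenth L i).-1)).

Lemma semidecidable_univ :
  semidecidable (fun z => univ (nleft z) (nleft (nright z)) (nright (nright
    z))).
Proof.
rewrite /univ /justified /in_code; comp.
Qed.

Definition in_seq (s : seq (nat * (nat * nat))) e n m : Prop :=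
  (e, (n, m)) \in s.

Lemma closed_in_seq_cat s t : closed_computation (in_seq s) ->
  closed_computation (in_seq t) -> closed_computation (in_seq (s ++ t)).
Proof.
move=> Cs Ct e n m; rewrite /in_seq mem_cat => /orP[/Cs|/Ct];
  apply: justified_sub => ? ? ?; rewrite /in_seq mem_cat => ->//.
by rewrite orbT.
Qed.

Lemma closed_in_seq_cons s e n m : closed_computation (in_seq s) ->
  justified (in_seq s) e n m ->
  closed_computation (in_seq ((e, (n, m)) :: s)).
Proof.
have sub x y z : in_seq s x y z -> in_seq ((e, (n, m)) :: s) x y z.
  by rewrite /in_seq inE => ->; rewrite orbT.
move=> Cs J x y z; rewrite {1}/in_seq inE => /orP[/eqP[-> -> ->]|/Cs].
  exact: justified_sub sub J.
exact: justified_sub sub.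
Qed.

(** By induction on the program: concatenate the tables of the subcomputations and add the new
    result. *)
Lemma closed_computation_complete c n m : pr_eval c n m ->
  exists2 s, closed_computation (in_seq s) & in_seq s (prnum c) n m.
Proof.
have add s e x y : closed_computation (in_seq s) ->
  justified (in_seq s) e x y ->
    exists2 s, closed_computation (in_seq s) & in_seq s e x y.
  move=> Cs J; exists ((e, (x, y)) :: s); first exact: closed_in_seq_cons.
  by rewrite /in_seq mem_head.
have nil : closed_computation (in_seq [::]) by [].
elim: c n m => [| | | |f IHf g IHg|f IHf g IHg|f IHf g IHg|f IHf] n m /=.
1-4: by move=> ->; apply: (add [::]) => //; rewrite /justified !npairKE.
- move=> [u [v [/IHf[s Cs sf] /IHg[t Ct tg] ->]]].
  apply: (add (s ++ t)); first exact: closed_in_seq_cat.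
  rewrite /justified !npairKE /=; exists u, v.
  by rewrite /in_seq !mem_cat sf tg orbT.
- move=> [u /IHg[t Ct tg] /IHf[s Cs sf]].
  apply: (add (s ++ t)); first exact: closed_in_seq_cat.
  rewrite /justified !npairKE /=; exists u.
  by rewrite /in_seq !mem_cat sf tg orbT.
- rewrite -{4}(nunpairK n); move: (nleft n) (nright n) => a k.
  elim: k m => [|k IH] m.
    move=> /IHf[s Cs sf]; apply: (add s) => //.
    by rewrite /justified !npairKE /=.
  move=> [r /IH[s Cs sf] /IHg[t Ct tg]].
  apply: (add (s ++ t)); first exact: closed_in_seq_cat.
  rewrite /justified !npairKE /=; exists r.
  by rewrite /in_seq !mem_cat sf tg orbT.
- move=> [/IHf[s Cs sf] H].
  (* The tables of the [m] failed trials of the minimization are gathered into one. *)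
  have [t Ct Ht] : exists2 t, closed_computation (in_seq t) &
      forall i, i < m -> exists r, in_seq t (prnum f) (npair n i) r.+1.
    elim: m {Cs sf s} H => [|m IH] H; first by exists [::].
    have [i im|t Ct Ht] := IH; first exact/H/ltnW.
    have [r /IHf[s Cs sf]] := H m (ltnSn m).
    exists (s ++ t); first exact: closed_in_seq_cat.
    move=> i; rewrite ltnS leq_eqVlt => /predU1P[->|/Ht[r' tr]].
      by exists r; rewrite /in_seq mem_cat sf.
    by exists r'; rewrite /in_seq mem_cat tr orbT.
  apply: (add (s ++ t)); first exact: closed_in_seq_cat.
  rewrite /justified !npairKE /=; split.
    by rewrite /in_seq mem_cat sf.
  by move=> i /Ht[r tr]; exists r; rewrite /in_seq mem_cat tr orbT.
Qed.

Lemma univP c n m : univ (prnum c) n m <-> pr_eval c n m.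
Proof.
split=> [[L [Lcnm LJ]]|/closed_computation_complete[s Cs scnm]].
  apply: (@closed_computation_sound (in_code L)) => // e x y [i Li].
  have iL : i < L.
    by rewrite ltnNge; apply/negP => /codenth_default; rewrite Li.
  by have := LJ i iL; rewrite Li succnK !npairKE => -[].
pose L := CodeSeq.code [seq (npair z.1 (npair z.2.1 z.2.2)).+1 | z <- s].
have Ls e x y : in_code L e x y <-> in_seq s e x y.
  split=> [[i]|].
    rewrite /L codenthE CodeSeq.codeK /in_seq.
    case: (ltnP i (size s)) => [is_|si]; last by rewrite nth_default ?size_map.
    rewrite (nth_map (0, (0, 0)))//.
    case E : (nth _ _ _) => [e' [x' y']] /= [] H.
    have := congr1 nleft H; have := congr1 (nleft \o nright) H.
    have := congr1 (nright \o nright) H; rewrite /= !npairKE => <- <- <-.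
    by rewrite -E mem_nth.
  move=> sexy; exists (index (e, (x, y)) s).
  rewrite /L codenthE CodeSeq.codeK (nth_map (0, (0, 0))) ?index_mem//.
  by rewrite nth_index.
exists L; split; first exact/Ls.
move=> i iL; case E : (codenth L i) => [|z]; [by left|right].
rewrite succnK; apply: justified_sub (Cs _ _ _ _) => [? ? ? /Ls//|].
by apply/Ls; exists i; rewrite E !nunpairK.
Qed.

Lemma semidecidable_re A : re A -> semidecidable (fun n => A n).
Proof.
move=> [c ->].
apply: (@semidecidable_ext (fun n => exists m, univ (prnum c) n m)) => [n|].
  by split=> -[m /univP]; exists m.
have U := semidecidable_univ.
by apply/semidecidable_exists/(semidecidable_comp3 U); comp.
Qed.

(** Since [pr_eval] is deterministic, a function of outputs chosen pointwise is the one that the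
    program computes. *)
Lemma computable_choice (P : nat -> nat -> Prop) :
  (exists c, forall n, exists2 m, pr_eval c n m & P n m) ->
  exists2 f, computable f & forall n, P n (f n).
Proof.
move=> [c Hc]; have [f Hf] : {f : nat -> nat & forall n, pr_eval c n (f n) /\
  P n (f n)}.
  by apply: (@choice _ _ (fun n m => pr_eval c n m /\ P n m)) => n;
    case: (Hc n) => m; exists m.
exists f => [|n]; last by case: (Hf n).
have det c' n m m' : pr_eval c' n m -> pr_eval c' n m' -> m = m'.
  elim: c' n m m' => [| | | |a IHa b IHb|a IHa b IHb|a IHa b IHb|a IHa] n m m'
    /=.
  1-4: by move=> -> ->.
  - move=> [u [v [Hu Hv ->]]] [u' [v' [Hu' Hv' ->]]].
    by rewrite (IHa _ _ _ Hu Hu') (IHb _ _ _ Hv Hv').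
  - move=> [u Hu Hm] [u' Hu']; rewrite -(IHb _ _ _ Hu Hu') => /(IHa _ _ _ Hm).
    exact.
  - elim: (nright n) m m' => [|k IH] m m'; first exact: IHa.
    by move=> [r /IH Hr Hm] [r' /Hr <-] /(IHb _ _ _ Hm).
  - move=> [Hm lm] [Hm' lm']; case: (ltngtP m m') => // [/lm'|/lm] [r].
      by move=> /(IHa _ _ _ Hm).
    by move=> /(IHa _ _ _ Hm').
by exists c => n m; have [Hn _] := Hf n; split=> [/det/(_ Hn)|->].
Qed.

(** * Computable rational functions *)

Local Open Scope ring_scope.

Definition rat_computable (F : nat -> rat) : Prop :=
  exists2 f, computable f & forall n, F n = ratcode (f n).

Lemma rat_computable_frac a b c F :
  computable a -> computable b -> computable c ->
  (forall n, F n = ((a n)%:R - (b n)%:R) / (c n).+1%:R) -> rat_computable F.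
Proof.
move=> Ca Cb Cc HF; exists (fun n => npair (npair (a n) (b n)) (c n)).
  by comp.
by move=> n; rewrite HF /ratcode !npairKE.
Qed.

Lemma rat_computable_num F : rat_computable F ->
  exists a b c, [/\ computable a, computable b, computable c &
    forall n, F n = ((a n)%:R - (b n)%:R) / (c n).+1%:R].
Proof.
move=> [f Cf HF]; exists (fun n => nleft (nleft (f n))),
  (fun n => nright (nleft (f n))), (fun n => nright (f n)).
by split=> [| | |n]; [comp..|rewrite HF].
Qed.

Lemma rat_computable_ratcode f : computable f ->
  rat_computable (fun n => ratcode (f n)).
Proof. by move=> Cf; exists f. Qed.

Lemma rat_computable_posratcode f : computable f ->
  rat_computable (fun n => posratcode (f n)).
Proof.
move=> Cf; apply: (@rat_computable_frac (fun n => (nleft (f n)).+1)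
  (fun=> 0%N) (fun n => nright (f n))) => [| | |n]; try by comp.
by rewrite subr0.
Qed.

Lemma rat_computable_nat f : computable f ->
  rat_computable (fun n => (f n)%:R).
Proof.
move=> Cf; apply: (@rat_computable_frac f
  (fun=> 0%N) (fun n => 0%N)) => [| | |n]; try by comp.
by rewrite subr0 divr1.
Qed.

Lemma rat_computable_const c : rat_computable (fun=> c%:R).
Proof. exact/rat_computable_nat/computable_const. Qed.

Lemma rat_computable0 : rat_computable (fun=> 0).
Proof. exact: (rat_computable_const 0). Qed.

Lemma rat_computable_invS f : computable f ->
  rat_computable (fun n => (f n).+1%:R^-1).
Proof.
move=> Cf; apply: (@rat_computable_frac (fun=> 1%N)
  (fun=> 0%N) f) => [| | |n]; try by comp.
by rewrite subr0 div1r.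
Qed.

Lemma rat_computable_opp F : rat_computable F ->
  rat_computable (fun n => - F n).
Proof.
move=> /rat_computable_num[a [b [c [Ca Cb Cc HF]]]].
apply: (@rat_computable_frac b a c) => // n.
by rewrite HF -mulNr opprB.
Qed.

Lemma rat_computable_add F G : rat_computable F -> rat_computable G ->
  rat_computable (fun n => F n + G n).
Proof.
move=> /rat_computable_num[a [b [c [Ca Cb Cc HF]]]].
move=> /rat_computable_num[a' [b' [c' [Ca' Cb' Cc' HG]]]].
apply: (@rat_computable_frac (fun n => a n * (c' n).+1 + a' n * (c n).+1)%N
  (fun n => b n * (c' n).+1 + b' n * (c n).+1)%N
  (fun n => ((c n).+1 * (c' n).+1).-1)%N) => [| | |n]; try by comp.
rewrite HF HG prednK// addf_div ?pnatr_eq0// !natrD !natrM.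
by congr (_ / _); ring.
Qed.

Lemma rat_computable_mul F G : rat_computable F -> rat_computable G ->
  rat_computable (fun n => F n * G n).
Proof.
move=> /rat_computable_num[a [b [c [Ca Cb Cc HF]]]].
move=> /rat_computable_num[a' [b' [c' [Ca' Cb' Cc' HG]]]].
apply: (@rat_computable_frac (fun n => a n * a' n + b n * b' n)%N
  (fun n => a n * b' n + b n * a' n)%N
  (fun n => ((c n).+1 * (c' n).+1).-1)%N) => [| | |n]; try by comp.
rewrite HF HG prednK// mulf_div; congr (_ / _); last by rewrite natrM.
by rewrite !natrD !natrM; ring.
Qed.

Lemma rat_computable_comp F g : rat_computable F -> computable g ->
  rat_computable (fun n => F (g n)).
Proof.
by move=> [f Cf HF] Cg; exists (fun n => f (g n)) => [|n]; [comp|rewrite HF].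
Qed.
#[global] Hint Extern 1 (rat_computable _) =>
  match goal with
  | H : rat_computable ?f |- rat_computable (fun z => ?f (@?g z)) =>
    apply (rat_computable_comp H)
  end : comp.

Lemma rat_computable_ext F G : F =1 G -> rat_computable F -> rat_computable G.
Proof. by move=> /funext ->. Qed.

Lemma rat_computable_inv f : computable f ->
  rat_computable (fun n => (f n)%:R^-1).
Proof.
(* The Boolean factor gives [0] at argument [0], where the inverse is [0] by convention. *)
move=> Cf; apply: (@rat_computable_ext
    (fun n => (nat_of_bool (f n != 0%N))%:R * (f n).-1.+1%:R^-1)) => [n|].
  by case: (f n) => [|k]; rewrite ?mul0r ?invr0 ?mul1r.
apply: rat_computable_mul; last by apply: rat_computable_invS; comp.
by apply: rat_computable_nat; comp.
Qed.

Lemma decidable_ler F G : rat_computable F -> rat_computable G ->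
  decidable_pred (fun n => F n <= G n).
Proof.
move=> /rat_computable_num[a [b [c [Ca Cb Cc HF]]]].
move=> /rat_computable_num[a' [b' [c' [Ca' Cb' Cc' HG]]]].
(* Cross-multiplication, with subtracted terms moved across so that only natural numbers occur. *)
apply: (@decidable_ext (fun n => a n * (c' n).+1 + b' n * (c n).+1 <=
  a' n * (c n).+1 + b n * (c' n).+1)%N); last by comp.
move=> n; rewrite HF HG ler_pdivrMr ?ltr0n// mulrAC ler_pdivlMr ?ltr0n//.
rewrite -(ler_nat rat) !natrD !natrM !mulrBl lerBlDr.
by rewrite addrAC lerBrDr.
Qed.

Lemma decidable_ltr F G : rat_computable F -> rat_computable G ->
  decidable_pred (fun n => F n < G n).
Proof.
move=> CF CG; apply: (@decidable_ext (fun n => ~~ (G n <= F n))).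
  by move=> n; rewrite -ltNge.
exact/decidable_negb/decidable_ler.
Qed.
#[global] Hint Resolve rat_computable_ratcode rat_computable_posratcode
  rat_computable_nat rat_computable_const rat_computable0
  rat_computable_invS  rat_computable_inv rat_computable_opp
  rat_computable_add rat_computable_mul decidable_ler decidable_ltr : comp.

Lemma invS_small (R : realType) (e : R) : 0 < e ->
  exists N, forall n, (N <= n)%N -> n.+1%:R^-1 < e.
Proof.
move=> e0; have [N] := ltr_add_invr e0; rewrite add0r => HN; exists N => n Nn.
by apply: le_lt_trans HN; rewrite lef_pV2 ?posrE ?ltr0n// ler_nat ltnS.
Qed.

(** * Comparing distances in the dense sequence with rationals *)

Section distances.
Context (R : realType) (X : completeMetricType R) (alpha : nat -> X).
Hypothesis hX : computable_metric_space alpha.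

Lemma computable_dist_approx : exists2 q, computable q & forall v w k,
  `|mdist (alpha v) (alpha w) - ratr (ratcode (q (npair (npair v w) k)))|
    <= k.+1%:R^-1 :> R.
Proof.
have [_ [c Hc]] := hX.
pose P z m := `|mdist (alpha (nleft (nleft z))) (alpha (nright (nleft z))) -
   ratr (ratcode m)| <= (nright z).+1%:R^-1 :> R.
have [|q Cq Hq] := @computable_choice P.
  exists c => n; have [m Hm e] :=
    Hc (nleft (nleft n)) (nright (nleft n)) (nright n).
  exists m; first by rewrite !nunpairK in Hm.
  rewrite /P (le_trans e)// lef_pV2 ?posrE ?exprn_gt0 ?ltr0n//.
  by rewrite -natrX ler_nat ltn_expl.
by exists q => // v w k; have := Hq (npair (npair v w) k); rewrite /P !npairKE.
Qed.

Lemma semidecidable_dist_lt v w F :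
  computable v -> computable w -> rat_computable F ->
  semidecidable (fun n => mdist (alpha (v n)) (alpha (w n)) < ratr (F n)).
Proof.
move=> Cv Cw [f Cf HF]; have [q Cq Hq] := computable_dist_approx.
apply: (@semidecidable_ext (fun n => exists k,
  ratcode (q (npair (npair (v n) (w n)) k)) + k.+1%:R^-1 < ratcode (f n))) =>
    [n|].
  rewrite HF; split=> [[k]|].
    rewrite -(ltr_rat R) rmorphD/= fmorphV rmorph_nat; apply: le_lt_trans.
    by have := Hq (v n) (w n) k; rewrite ler_norml => /andP[_]; rewrite lerBlDl.
  (* Half of the gap, because the error enters twice: in the approximation and as the added
     margin. *)
  rewrite -subr_gt0 => e0; have [N HN] := invS_small (divr_gt0 e0 (ltr0Sn R 1)).
  exists N; rewrite -(ltr_rat R) rmorphD/= fmorphV rmorph_nat.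
  have := Hq (v n) (w n) N; have := HN N (leqnn _); rewrite ler_norml.
  set d := mdist _ _; set r := ratr _; set r' := ratr _; set u := _^-1; lra.
by comp.
Qed.

Lemma semidecidable_dist_gt v w F :
  computable v -> computable w -> rat_computable F ->
  semidecidable (fun n => ratr (F n) < mdist (alpha (v n)) (alpha (w n))).
Proof.
move=> Cv Cw [f Cf HF]; have [q Cq Hq] := computable_dist_approx.
apply: (@semidecidable_ext (fun n => exists k,
  ratcode (f n) + k.+1%:R^-1 < ratcode (q (npair (npair (v n) (w n)) k)))) =>
    [n|].
  rewrite HF; split=> [[k]|].
    rewrite -(ltr_rat R) rmorphD/= fmorphV rmorph_nat.
    have := Hq (v n) (w n) k; rewrite ler_norml.
    set d := mdist _ _; set r := ratr _; set r' := ratr _; set u := _^-1; lra.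
  rewrite -subr_gt0 => e0; have [N HN] := invS_small (divr_gt0 e0 (ltr0Sn R 1)).
  exists N; rewrite -(ltr_rat R) rmorphD/= fmorphV rmorph_nat.
  have := Hq (v n) (w n) N; have := HN N (leqnn _); rewrite ler_norml.
  set d := mdist _ _; set r := ratr _; set r' := ratr _; set u := _^-1; lra.
by comp.
Qed.

End distances.

(** * The Prokhorov distance *)

Local Open Scope classical_set_scope.
Local Open Scope ring_scope.

Section prokhorov.
Context (R : realType) (X : completeMetricType R).
Implicit Types (A B : set X) (x y : X) (mu nu la : probability (borelType X) R).

Definition prob mu A : R := fine (mu A).

Lemma probE mu (A : set (borelType X)) : measurable A -> mu A = (prob mu A)%:E.
Proof. by move=> mA; rewrite fineK// fin_num_measure. Qed.

Lemma prob_ge0 mu A : 0 <= prob mu A.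
Proof. exact: fine_ge0. Qed.

Lemma prob_setC mu (A : set (borelType X)) : measurable A ->
  prob mu (~` A) = 1 - prob mu A.
Proof.
move=> mA; apply: EFin_inj; rewrite EFinB -!probE//; last exact: measurableC.
exact: probability_setC.
Qed.

Lemma le_prob mu (A B : set (borelType X)) : measurable A -> measurable B ->
  A `<=` B -> prob mu A <= prob mu B.
Proof.
by move=> mA mB AB; rewrite -lee_fin -!probE// le_measure// inE.
Qed.

Lemma prob_le1 mu (A : set (borelType X)) : measurable A -> prob mu A <= 1.
Proof. by move=> mA; rewrite -lee_fin -probE// probability_le1. Qed.

Lemma open_mdist x (e : R) : open [set y | mdist x y < e].
Proof.
rewrite openE => y /= xy; apply/nbhs_ballP; exists (e - mdist x y) => /=.
  by rewrite subr_gt0.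
move=> z; rewrite ballEmdist /= => yz.
by have := metric_triangle x y z; lra.
Qed.

Lemma open_borel A : open A -> measurable (A : set (borelType X)).
Proof. by move=> oA; apply: sub_sigma_algebra. Qed.

Lemma measurable_singleton x : measurable ([set x] : set (borelType X)).
Proof.
have -> : [set x] = \bigcap_k [set y | mdist x y < k.+1%:R^-1].
  apply/seteqP; split=> [_ -> k _ /=|y xy]; first by rewrite mdistxx invr_gt0.
  apply/esym/mdist_positivity/eqP; rewrite eq_le mdist_ge0 andbT.
  rewrite leNgt; apply/negP => /invS_small[k Hk].
  by have := xy k I; rewrite /= ltNge => /negP; apply; exact/ltW/Hk.
apply: bigcap_measurable => [|k _]; first by exists 0%N.
by apply: open_borel; exact: open_mdist.
Qed.

Lemma enlargeP A e x : enlarge A e x <-> exists2 a, A a & mdist x a < e.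
Proof.
rewrite /enlarge /dist_set /=; split.
  by move=> /ereal_inf_ltP[_ [a Aa <-]]; rewrite lte_fin; exists a.
move=> [a Aa xa]; apply/ereal_inf_ltP; exists (mdist x a)%:E;
  last by rewrite lte_fin.
by exists a.
Qed.

Lemma open_enlarge A e : open (enlarge A e).
Proof.
have -> : enlarge A e = \bigcup_(a in A) [set y | mdist a y < e].
  apply/seteqP; split=> x.
    by move=> /enlargeP[a Aa xa]; exists a => //=; rewrite metric_sym.
  by move=> [a Aa /= ax]; apply/enlargeP; exists a => //; rewrite metric_sym.
by apply: bigcup_open => a _; exact: open_mdist.
Qed.

Lemma measurable_enlarge A e : measurable (enlarge A e : set (borelType X)).
Proof. exact: (open_borel (open_enlarge A e)). Qed.

Lemma sub_enlarge A B e d : A `<=` B -> e <= d -> enlarge A e `<=` enlarge B d.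
Proof.
move=> AB ed x /enlargeP[a Aa xa]; apply/enlargeP; exists a; first exact: AB.
exact: lt_le_trans ed.
Qed.

Definition prokhorov_close mu nu (e : R) : Prop :=
  forall A : set (borelType X), measurable A ->
    prob mu A <= prob nu (enlarge A e) + e.

Let E mu nu := [set e : R | 0 < e /\
    forall A : set (borelType X), measurable A ->
      (mu A <= nu (enlarge A e) + e%:E)%E].

Let EP mu nu e : E mu nu e <-> 0 < e /\ prokhorov_close mu nu e.
Proof.
split=> -[e0 H]; split=> // A mA; have := H A mA.
  by rewrite !probE// ?lee_fin//; exact: measurable_enlarge.
by rewrite !probE// ?lee_fin//; exact: measurable_enlarge.
Qed.

Let E_lbound mu nu : has_lbound (E mu nu).
Proof. by exists 0 => e [/ltW]. Qed.

Let E_nonempty mu nu : E mu nu !=set0.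
Proof.
exists 1; apply/EP; split=> // A mA.
by rewrite (le_trans (prob_le1 mu mA))// lerDr prob_ge0.
Qed.

Lemma prokhorov_le mu nu e :
  0 < e -> prokhorov_close mu nu e -> prokhorov mu nu <= e.
Proof. by move=> e0 H; apply: ge_inf; [exact: E_lbound|exact/EP]. Qed.

(** Enlargements grow with the radius, so the set defining the infimum is closed upwards. *)
Lemma prokhorov_lt mu nu e :
  prokhorov mu nu < e -> 0 < e /\ prokhorov_close mu nu e.
Proof.
move=> /(inf_lt (E_nonempty mu nu))[d /EP[d0 H] de]; split;
  first exact: lt_trans de.
move=> A mA; rewrite (le_trans (H A mA))// lerD//; last exact: ltW.
by apply: le_prob; [exact: measurable_enlarge..|apply: sub_enlarge => //;
  exact: ltW].
Qed.

Lemma prokhorov_le1 mu nu : prokhorov mu nu <= 1.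
Proof.
apply: prokhorov_le => // A mA.
by rewrite (le_trans (prob_le1 mu mA))// lerDr prob_ge0.
Qed.

(* Apply closeness to the complement of the enlargement of A. *)
Lemma prokhorov_close_sym mu nu e :
  prokhorov_close mu nu e -> prokhorov_close nu mu e.
Proof.
move=> H A mA; have mAe := measurable_enlarge A e.
have := H _ (measurableC mAe); rewrite prob_setC//.
suff : prob nu (enlarge (~` enlarge A e) e) <= prob nu (~` A).
  by rewrite (prob_setC nu mA); lra.
apply: le_prob; [exact: measurable_enlarge|exact: measurableC|].
move=> x /enlargeP[y yA xy] Ax; apply: yA; apply/enlargeP; exists x => //.
by rewrite metric_sym.
Qed.

Lemma prokhorov_sym mu nu : prokhorov mu nu = prokhorov nu mu.
Proof.
rewrite /prokhorov; congr inf; apply/seteqP; split=> e /EP[e0 H];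
  by apply/EP; split=> //; exact: prokhorov_close_sym.
Qed.

Lemma prokhorov_triangle nu mu la :
  prokhorov mu la <= prokhorov mu nu + prokhorov nu la.
Proof.
apply/ler_addgt0Pr => e e0.
have [d0 H] : 0 < prokhorov mu nu + e / 2 /\
    prokhorov_close mu nu (prokhorov mu nu + e / 2).
  by apply: prokhorov_lt; rewrite ltrDl divr_gt0.
have [d0' H'] : 0 < prokhorov nu la + e / 2 /\
    prokhorov_close nu la (prokhorov nu la + e / 2).
  by apply: prokhorov_lt; rewrite ltrDl divr_gt0.
move: H H' d0 d0'; set d := prokhorov mu nu + _; set d' := prokhorov nu la + _.
move=> H H' d0 d0'.
have -> : prokhorov mu nu + prokhorov nu la + e = d + d' by rewrite /d /d'; lra.
apply: prokhorov_le => [|A mA]; first exact: addr_gt0.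
have mAe := measurable_enlarge A d.
have := H A mA; have := H' _ mAe.
suff : prob la (enlarge (enlarge A d) d') <= prob la (enlarge A (d + d')) by
  lra.
apply: le_prob; [exact: measurable_enlarge..|].
move=> x /enlargeP[y /enlargeP[z Az yz] xy]; apply/enlargeP; exists z => //.
by have := metric_triangle x y z; lra.
Qed.

End prokhorov.

(** * Finitely supported rational measures *)

Definition weight_sum (n : nat) : nat :=
  (\sum_(0 <= i < n) nright (codenth n i))%N.

(* The measure with code [n] has atoms at the positions [i <= n]: those of the
   sequence coded by [n], whose length is at most [n], and the default atom of
   [ratmeasure] at position [n], with weight [1] if the other weights vanish. *)
Definition atom (n i : nat) : nat := nleft (codenth n i).
Definition weight (n i : nat) : nat :=
  (nright (codenth n i) + ((i == n) && (weight_sum n == 0)))%N.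
Definition mass (n : nat) (P : nat -> bool) : nat :=
  (\sum_(0 <= i < n.+1) weight n i * P i)%N.
Definition total_weight (n : nat) : nat := mass n xpredT.

(** Position [n] lies beyond the coded sequence: its atom has index [0], and its weight is [1]
    exactly if the other weights vanish. *)
Lemma sum_weight (V : nmodType) (F : nat -> nat -> V) n :
  (forall i, F 0%N i = 0) ->
  \sum_(0 <= i < n.+1) F (weight n i) (atom n i) =
  \sum_(0 <= i < n) F (nright (codenth n i)) (atom n i) +
    F (nat_of_bool (weight_sum n == 0%N)) 0%N.
Proof.
move=> F0; rewrite big_nat_recr//=; congr (_ + _).
  by apply: eq_big_nat => i /andP[_ i_n]; rewrite /weight (ltn_eqF i_n) addn0.
by rewrite /weight /atom codenth_default// eqxx.
Qed.

Lemma total_weightE n : total_weight n = (weight_sum n + (weight_sum n == 0))%N.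
Proof.
rewrite /total_weight /mass; under eq_bigr do rewrite muln1.
exact: (@sum_weight nat (fun w _ => w)).
Qed.

Lemma total_weight_gt0 n : (0 < total_weight n)%N.
Proof. by rewrite total_weightE; case: (weight_sum n). Qed.

Lemma sum_decode (V : nmodType) (F : nat -> V) n : F 0%N = 0 ->
  \sum_(0 <= i < n) F (codenth n i) = \sum_(x <- CodeSeq.decode n) F x.
Proof.
move=> F0; rewrite [RHS](big_nth 0%N) (big_cat_nat (leq0n _) (size_decode
  n))//=.
rewrite [X in _ + X]big_nat_cond [X in _ + X]big1 => [|i /andP[/andP[si _] _]].
  by rewrite addr0; apply: eq_bigr => i _; rewrite codenthE.
by rewrite codenthE nth_default.
Qed.

Section ratmeasure.
Context (R : realType) (X : completeMetricType R) (alpha : nat -> X).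

Lemma invr_total_weight_ge0 n : 0 <= (total_weight n)%:R^-1 :> R.
Proof. by rewrite invr_ge0. Qed.

(** [ratmeasure] without case distinction: the default atom makes the total weight positive. Masses
    and integrals become finite sums. *)
Definition atomic_measure (n : nat) : {measure set (borelType X) -> \bar R} :=
  mscale (NngNum (invr_total_weight_ge0 n))
    (msum (fun i => mscale (NngNum (ler0n R (weight n i)))
             (@dirac _ (borelType X) (alpha (atom n i)) R)) n.+1).

Lemma ratmeasureE n (A : set (borelType X)) :
  ratmeasure alpha n A = atomic_measure n A.
Proof.
pose D i : probability (borelType X) R := @dirac _ (borelType X) (alpha i) R.
pose F (U : set (borelType X)) w i := (w%:R%:E * D i U)%E.
have F0 U i : F U 0%N i = 0%E by rewrite /F mul0e.
pose s := CodeSeq.decode n.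
pose M : {measure set (borelType X) -> \bar R} :=
  msum (fun i => mscale (NngNum (ler0n R (nright (nth 0%N s i))))
    (D (nleft (nth 0%N s i)))) (size s).
have ME U : M U = (\sum_(0 <= i < n) F U (nright (codenth n i)) (atom n i))%E.
  rewrite (@sum_decode _ (fun x => F U (nright x) (nleft x)))//.
  by rewrite (big_nth 0%N) big_mkord.
have MT : M setT = (weight_sum n)%:R%:E.
  rewrite ME; under eq_bigr do rewrite /F /D /= diracT mule1.
  by rewrite sumEFin -natr_sum.
have -> : atomic_measure n A = ((total_weight n)%:R^-1%:E *
    (M A + F A (nat_of_bool (weight_sum n == 0%N)) 0%N))%E.
  rewrite ME -sum_weight// /= /mscale /msum /=; congr (_ * _)%E.
  by rewrite big_mkord.
rewrite -[LHS]/(mnormalize M (D 0%N) A) /mnormalize MT.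
rewrite total_weightE orbF eqe pnatr_eq0; case: eqVneq => [w0|w0].
  rewrite w0 add0n invr1 mul1e ME big_nat_cond big1 =>
    [|i /andP[/andP[_ i_n] _]].
    by rewrite add0e /F mul1e.
  move/eqP: w0; rewrite /weight_sum big_mkord sum_nat_eq0.
  by move=> /forallP/(_ (Ordinal i_n))/= /eqP ->.
by rewrite addn0 F0 adde0 muleC.
Qed.

Lemma probability_ratmeasure n (A : set (borelType X)) :
  prob (ratmeasure alpha n) A =
  (mass n (fun i => alpha (atom n i) \in A))%:R / (total_weight n)%:R.
Proof.
rewrite /prob ratmeasureE /= /mscale /= /msum.
rewrite (eq_bigr (fun i : 'I_n.+1 =>
    ((weight n i * (alpha (atom n i) \in A))%N%:R)%:E)) => [|i _].
  by rewrite sumEFin -natr_sum -EFinM /= mulrC /mass big_mkord.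
by rewrite natrM EFinM.
Qed.

Lemma integral_ratmeasure (n : nat) (f : borelType X -> \bar R) :
  measurable_fun [set: borelType X] f -> (forall x, 0 <= f x)%E ->
  (\int[ratmeasure alpha n]_x f x =
   (total_weight n)%:R^-1%:E * \sum_(0 <= i < n.+1) (weight n i)%:R%:E *
     f (alpha (atom n i)))%E.
Proof.
move=> mf f0; rewrite (@eq_measure_integral _ _ _ _ (atomic_measure n));
  last first.
  by move=> A _ _; exact: ratmeasureE.
rewrite ge0_integral_mscale//= ge0_integral_measure_sum// big_mkord.
congr (_ * _)%E; apply: eq_bigr => i _.
by rewrite ge0_integral_mscale//= integral_dirac// diracT mul1e.
Qed.

End ratmeasure.

Lemma mass_decode n (Q : nat -> bool) : weight_sum n != 0%N ->
  mass n (fun i => Q (atom n i)) =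
  (\sum_(x <- CodeSeq.decode n) nright x * Q (nleft x))%N.
Proof.
move=> w0; rewrite /mass (@sum_weight nat (fun w a => w * Q a)%N)//.
rewrite (negbTE w0) mul0n addr0.
exact: (@sum_decode nat (fun x => nright x * Q (nleft x))%N).
Qed.

Lemma weight_sum_decode n :
  weight_sum n = (\sum_(x <- CodeSeq.decode n) nright x)%N.
Proof. exact: (@sum_decode nat nright). Qed.

(** * Density of the rational measures *)

Section density.
Context (R : realType) (X : completeMetricType R) (alpha : nat -> X).

Lemma sum_prob_le (mu : probability (borelType X) R)
    (D : nat -> set (borelType X)) (B : set (borelType X)) (Q : nat -> bool) M :
  (forall v, measurable (D v)) -> trivIset setT D -> measurable B ->
  (forall v, Q v -> D v `<=` B) ->
  \sum_(v < M) prob mu (D v) * (Q v)%:R <= prob mu B.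
Proof.
move=> mD tD mB DB; pose F v := if Q v then D v else set0.
have mF v : measurable (F v) by rewrite /F; case: ifP.
have tF : trivIset setT F.
  move/trivIsetP: tD => tD; apply/trivIsetP => i j _ _ ij; rewrite /F.
  by case: ifP => _; rewrite ?set0I//; case: ifP => _; rewrite ?setI0// tD.
rewrite -lee_fin -probE// -sumEFin.
rewrite (eq_bigr (fun v : 'I_M => mu (F v))) => [|v _]; last first.
  by rewrite /F; case: (Q v); rewrite ?mulr1 ?mulr0 ?measure0// probE.
rewrite -measure_bigsetU//; apply: le_measure; rewrite ?inE//.
  by apply: bigsetU_measurable.
rewrite -bigcup_mkord => x [v _]; rewrite /F; case: ifP => // Qv; exact: DB.
Qed.

(* Cut the space into small pieces around the points of the dense sequence,
   round the measures of finitely many of them down to multiples of [1 / L],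
   and give the remaining mass to an arbitrary point. *)
Lemma ratmeasure_dense (mu : probability (borelType X) R) (e : R) :
  dense (range alpha) -> 0 < e ->
  exists n, prokhorov (ratmeasure alpha n) mu < e.
Proof.
move=> da e0; have [d [d0 de]] : exists d : R, 0 < d /\ d < e.
  by exists (e / 2); split; lra.
suff [n Hn] : exists n, prokhorov_close (ratmeasure alpha n) mu d.
  by exists n; apply: le_lt_trans de; exact: prokhorov_le.
pose U v : set (borelType X) := [set y | mdist (alpha v) y < d].
have mU v : measurable (U v) by exact: (open_borel (@open_mdist _ X _ _)).
(* The balls [U v] cover the space by density; [D] makes them disjoint. *)
pose D := seqDU U.
have mD v : measurable (D v) by exact: seqDU_measurable.
have tD : trivIset setT D by exact: trivIset_seqDU.
have UT : \bigcup_v D v = setT.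
  rewrite -seqDU_bigcup_eq; apply/seteqP; split=> // x _.
  have [||y [/= xy [v _ vy]]] := da [set y | mdist x y < d].
  - by exists x; rewrite /= mdistxx.
  - exact: open_mdist.
  by exists v => //=; rewrite /U /= vy metric_sym.
pose m v := prob mu (D v).
have m0 v : 0 <= m v by exact: prob_ge0.
(* By countable additivity, finitely many pieces carry all but [d / 2] of the mass; rounding may use
   up the other [d / 2]. *)
have [M HM] : exists M, 1 - d / 2 < \sum_(v < M) m v.
  apply: contrapT => /forallNP H.
  have : (mu (\bigcup_v D v) <= (1 - d / 2)%:E)%E.
    rewrite measure_bigcup//.
    rewrite (eq_eseriesl (Q := xpredT)); last by move=> i /=; rewrite in_setT.
    apply: lime_le; first exact: is_cvg_nneseries.
    apply: nearW => M; rewrite big_mkord.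
    rewrite (eq_bigr (fun v : 'I_M => (m v)%:E)) => [|v _]; last exact: probE.
    by rewrite sumEFin lee_fin leNgt; apply/negP/H.
  by rewrite UT probability_setT lee_fin; lra.
(* Rounding loses at most [1 / L] on each of [M] pieces, hence at most [d / 2]. *)
have [L L0 HL] : exists2 L, (0 < L)%N & M%:R <= L%:R * (d / 2).
  exists (Num.truncn (M%:R / (d / 2))).+1 => //.
  by rewrite -ler_pdivrMr ?divr_gt0//; apply/ltW/truncnS_gt.
pose w v := Num.truncn (L%:R * m v).
have w_le v : (w v)%:R <= L%:R * m v by rewrite truncn_le mulr_ge0.
have w_ge v : L%:R * m v - 1 <= (w v)%:R.
  by rewrite lerBlDr natr1; apply/ltW/truncnS_gt.
have summ1 : \sum_(v < M) m v <= 1.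
  have := @sum_prob_le mu D setT xpredT M mD tD measurableT (fun _ _ _ _ => I).
  under eq_bigr do rewrite mulr1.
  by move=> /le_trans; apply; exact: prob_le1.
have wL : (\sum_(v < M) w v <= L)%N.
  rewrite -(ler_nat R) natr_sum (@le_trans _ _ (L%:R * \sum_(v < M) m v))//.
    by rewrite mulr_sumr ler_sum.
  by rewrite -[leRHS]mulr1 ler_wpM2l.
pose l := (L - \sum_(v < M) w v)%N.
have l_le : l%:R <= L%:R * d.
  rewrite natrB// natr_sum.
  have : \sum_(v < M) (L%:R * m v - 1) <= \sum_(v < M) (w v)%:R :> R.
    by rewrite ler_sum.
  rewrite sumrB sumr_const card_ord -mulr_sumr.
  have : L%:R * (1 - d / 2) <= L%:R * \sum_(v < M) m v.
    by rewrite ler_wpM2l// ltW.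
  lra.
(* The leftover weight [l], at most [L * d], goes to [alpha 0], which makes the total exactly
   [L]. *)
pose s := npair 0 l :: [seq npair v (w v) | v <- iota 0 M].
have sumS (F : nat -> nat) : (\sum_(x <- s) F x =
    F (npair 0 l) + \sum_(v < M) F (npair v (w v)))%N.
  by rewrite big_cons big_map -{1}[M]subn0 -/(index_iota 0 M) big_mkord.
pose n := CodeSeq.code s;
  have sE : CodeSeq.decode n = s by rewrite CodeSeq.codeK.
have WL : weight_sum n = L.
  rewrite weight_sum_decode sE sumS npairKr.
  by under eq_bigr do rewrite npairKr; rewrite subnK.
exists n => A mA; rewrite probability_ratmeasure total_weightE WL (gtn_eqF L0)
  addn0.
rewrite (@mass_decode _ (fun a => alpha a \in A)) ?WL -?lt0n// sE sumS.
rewrite ler_pdivrMr ?ltr0n// natrD !npairKE.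
under eq_bigr do rewrite !npairKE.
have : (l * (alpha 0%N \in A))%:R <= l%:R :> R.
  by rewrite ler_nat; case: (_ \in _); rewrite ?muln1 ?muln0.
suff : (\sum_(v < M) w v * (alpha v \in A))%:R <=
    L%:R * prob mu (enlarge A d) by lra.
have : \sum_(v < M) m v * (alpha v \in A)%:R <= prob mu (enlarge A d).
  apply: (@sum_prob_le mu D _ (fun v => alpha v \in A)) => //.
    exact: measurable_enlarge.
  move=> v; rewrite inE => Av x Dx; have := @subset_seqDU _ U v x Dx;
    rewrite /U /= => vx.
  by apply/enlargeP; exists (alpha v) => //; rewrite metric_sym.
rewrite -(ler_pM2l (_ : 0 < L%:R)) ?ltr0n//; apply: le_trans.
rewrite natr_sum mulr_sumr ler_sum// => v _.
by rewrite natrM mulrA ler_wpM2r.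
Qed.

End density.

Lemma computable_weight_sum f : computable f ->
  computable (fun n => weight_sum (f n)).
Proof. by move=> Cf; rewrite /weight_sum; comp. Qed.
#[global] Hint Resolve computable_weight_sum : comp.

Lemma computable_atom f g : computable f -> computable g ->
  computable (fun n => atom (f n) (g n)).
Proof. by move=> Cf Cg; rewrite /atom; comp. Qed.

Lemma computable_weight f g : computable f -> computable g ->
  computable (fun n => weight (f n) (g n)).
Proof. by move=> Cf Cg; rewrite /weight; comp. Qed.
#[global] Hint Resolve computable_atom computable_weight : comp.

Lemma computable_mass_bit f g : computable f -> computable g ->
  computable (fun n => mass (f n) (bit (g n))).
Proof. by move=> Cf Cg; rewrite /mass; comp. Qed.

Lemma computable_total_weight f : computable f -> computable (fun n =>
  total_weight (f n)).
Proof. by move=> Cf; rewrite /total_weight /mass; comp. Qed.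
#[global] Hint Resolve computable_mass_bit computable_total_weight : comp.

Lemma leq_mass n (P Q : nat -> bool) :
  (forall i, (i < n.+1)%N -> P i -> Q i) -> (mass n P <= mass n Q)%N.
Proof.
move=> PQ; rewrite /mass !big_mkord leq_sum// => i _.
by rewrite leq_mul2l; case E : (P i); rewrite ?orbT// PQ// orbT.
Qed.

(** * Semidecidable bounds on the distance of rational measures *)

Section prokhorov_ratmeasure.
Context (R : realType) (X : completeMetricType R) (alpha : nat -> X).
Hypothesis hX : computable_metric_space alpha.

Let dist_lt := semidecidable_dist_lt hX.
Let dist_gt := semidecidable_dist_gt hX.
Hint Resolve dist_lt dist_gt : comp.

(* [A] and [J] code sets of atoms in binary. *)
Definition prokhorov_below (m m' : nat) (e : rat) : Prop :=
  0 < e /\ forall A, (A < 2 ^ m.+1)%N -> exists J,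
    (forall j, (j < m'.+1)%N -> ~~ bit J j \/ exists i,
      [&& i < m.+1 & bit A i]%N /\
       mdist (alpha (atom m i)) (alpha (atom m' j)) < ratr e) /\
    (mass m (bit A))%:R / (total_weight m)%:R <=
      (mass m' (bit J))%:R / (total_weight m')%:R + e.

(** A failure of closeness at [A]. Here [J] contains every atom in the enlargement of [A], while the
    [J] of [prokhorov_below] contains only such atoms. *)
Definition prokhorov_above (m m' : nat) (e : rat) : Prop :=
  exists A, exists J,
    (forall j, (j < m'.+1)%N -> bit J j \/
       forall i, (i < m.+1)%N -> ~~ bit A i \/
         ratr e < mdist (alpha (atom m i)) (alpha (atom m' j))) /\
    (mass m' (bit J))%:R / (total_weight m')%:R + e <
      (mass m (bit A))%:R / (total_weight m)%:R.

Lemma semidecidable_prokhorov_below a b F :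
  computable a -> computable b -> rat_computable F ->
  semidecidable (fun n => prokhorov_below (a n) (b n) (F n)).
Proof. by move=> Ca Cb CF; rewrite /prokhorov_below; comp. Qed.

Lemma semidecidable_prokhorov_above a b F :
  computable a -> computable b -> rat_computable F ->
  semidecidable (fun n => prokhorov_above (a n) (b n) (F n)).
Proof. by move=> Ca Cb CF; rewrite /prokhorov_above; comp. Qed.

Let ratm := ratmeasure alpha.

Lemma prob_le_mass n (A : set (borelType X)) (Q : nat -> bool) :
  (forall i, (i < n.+1)%N -> A (alpha (atom n i)) -> Q i) ->
  prob (ratm n) A <= (mass n Q)%:R / (total_weight n)%:R.
Proof.
move=> AQ; rewrite probability_ratmeasure ler_pM2r ?invr_gt0 ?ltr0n
  ?total_weight_gt0//.
by rewrite ler_nat leq_mass// => i i_n; rewrite inE; exact: AQ.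
Qed.

Lemma mass_le_prob n (A : set (borelType X)) (Q : nat -> bool) :
  (forall i, (i < n.+1)%N -> Q i -> A (alpha (atom n i))) ->
  (mass n Q)%:R / (total_weight n)%:R <= prob (ratm n) A.
Proof.
move=> AQ; rewrite probability_ratmeasure ler_pM2r ?invr_gt0 ?ltr0n
  ?total_weight_gt0//.
by rewrite ler_nat leq_mass// => i i_n Qi; rewrite inE; exact: AQ.
Qed.

Let atoms m A : set (borelType X) :=
  [set alpha (atom m i) | i in [set i | (i < m.+1)%N && bit A i]].

Let measurable_atoms m A : measurable (atoms m A).
Proof.
have -> : atoms m A =
    \bigcup_(i in [set i | (i < m.+1)%N && bit A i]) [set alpha (atom m i)].
  by apply/seteqP; split=> x [i im ix]; exists i.
by apply: bigcup_measurable => i _; exact: measurable_singleton.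
Qed.

(** Replacing a Borel set by the atoms of [m] in it keeps its mass under [ratm m] and can only
    shrink its enlargement, so finitely many sets suffice. *)
Lemma prokhorov_below_le m m' e :
  prokhorov_below m m' e -> prokhorov (ratm m) (ratm m') <= ratr e.
Proof.
move=> [e0 H]; apply: prokhorov_le => [|B mB]; first by rewrite ltr0q.
have [A Am HA] := bit_surj (fun i => alpha (atom m i) \in B) m.+1.
have [J [HJ]] := H A Am.
rewrite -(ler_rat R) rmorphD /= !fmorph_div /= !rmorph_nat.
have : prob (ratm m) B <= (mass m (bit A))%:R / (total_weight m)%:R.
  by apply: prob_le_mass => i im Bi; rewrite HA// inE.
suff : (mass m' (bit J))%:R / (total_weight m')%:R <= prob (ratm m') (enlarge B
  (ratr e)).
  set x := _ / _; set y := _ / _; lra.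
apply: mass_le_prob => j jm' Jj.
have [/negP//|[i [/andP[im Ai] ij]]] := HJ j jm'.
apply/enlargeP; exists (alpha (atom m i)); last by rewrite metric_sym.
by move: Ai; rewrite HA// inE.
Qed.

Lemma prokhorov_lt_below m m' e :
  prokhorov (ratm m) (ratm m') < ratr e -> prokhorov_below m m' e.
Proof.
move=> /prokhorov_lt[e0 H]; split; first by rewrite -(ltr0q R).
move=> A _; pose B := atoms m A; have mB := measurable_atoms m A.
have [J _ HJ] := bit_surj (fun j =>
  alpha (atom m' j) \in enlarge B (ratr e)) m'.+1.
exists J; split=> [j jm'|].
  rewrite HJ//; case: (boolP (_ \in _)); last by left.
  rewrite inE => /enlargeP[_ [i im <-] ij]; right; exists i; split => //.
  by rewrite metric_sym.
rewrite -(ler_rat R) rmorphD /= !fmorph_div /= !rmorph_nat.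
have := H B mB.
have : (mass m (bit A))%:R / (total_weight m)%:R <= prob (ratm m) B.
  by apply: mass_le_prob => i im Ai; exists i => //=; rewrite im.
have : prob (ratm m') (enlarge B (ratr e)) <=
    (mass m' (bit J))%:R / (total_weight m')%:R.
  by apply: prob_le_mass => j jm' Bj; rewrite HJ// inE.
set x := _ / _; set y := _ / _; lra.
Qed.

Lemma prokhorov_above_ge m m' e :
  prokhorov_above m m' e -> ratr e <= prokhorov (ratm m) (ratm m').
Proof.
move=> [A [J [HJ]]]; rewrite -(ltr_rat R) rmorphD /= !fmorph_div /= !rmorph_nat.
move=> H; rewrite leNgt; apply/negP => /prokhorov_lt[e0 close].
have := close _ (measurable_atoms m A).
have : (mass m (bit A))%:R / (total_weight m)%:R <= prob (ratm m) (atoms m A).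
  by apply: mass_le_prob => i im Ai; exists i => //=; rewrite im.
have : prob (ratm m') (enlarge (atoms m A) (ratr e)) <=
    (mass m' (bit J))%:R / (total_weight m')%:R.
  apply: prob_le_mass => j jm' /enlargeP[_ [i /andP[im Ai] <-] ij].
  have [//|/(_ i im)[/negP//|]] := HJ j jm'.
  by rewrite metric_sym => /lt_trans/(_ ij); rewrite ltxx.
move: H; set x := _ / _; set y := _ / _; lra.
Qed.

Lemma prokhorov_gt_above m m' e :
  ratr e < prokhorov (ratm m) (ratm m') -> prokhorov_above m m' e.
Proof.
(* For negative [e], empty [A] and [J] work. *)
move=> ep; case: (ltP e 0) => e0.
  have [A _ HA] := bit_surj xpred0 m.+1.
  have [J _ HJ] := bit_surj xpred0 m'.+1.
  exists A, J; split=> [j jm'|].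
    by right => i im; left; rewrite HA.
  apply: (@lt_le_trans _ _ 0); last by rewrite divr_ge0.
  suff -> : mass m' (bit J) = 0%N by rewrite mul0r add0r.
  by rewrite /mass big_mkord big1// => i _; rewrite HJ ?muln0.
(* Closeness fails at the midpoint [d], and atoms outside the [d]-enlargement are at distance at
   least [d], hence strictly more than [e]. *)
pose d := (ratr e + prokhorov (ratm m) (ratm m')) / 2.
have re0 : 0 <= ratr e :> R by rewrite ler0q.
have ed : ratr e < d by rewrite /d; lra.
have /existsNP[B /not_implyP[mB /negP]] :
  ~ prokhorov_close (ratm m) (ratm m') d.
  move=> /prokhorov_le; rewrite leNgt => /(_ (le_lt_trans re0 ed))/negP; apply.
  by rewrite /d; lra.
rewrite -ltNge => HB.
have [A _ HA] := bit_surj (fun i => alpha (atom m i) \in B) m.+1.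
have [J _ HJ] := bit_surj (fun j => alpha (atom m' j) \in enlarge B d) m'.+1.
exists A, J; split=> [j jm'|].
  rewrite HJ//; case: (boolP (_ \in _)) => [|jB]; [by left|right => i im].
  rewrite HA//; case: (boolP (_ \in B)) => [|_]; [|by left].
  rewrite inE => iB; right; apply: lt_le_trans ed _.
  rewrite leNgt; apply: contra jB => ij; rewrite inE; apply/enlargeP.
  by exists (alpha (atom m i)) => //; rewrite metric_sym.
rewrite -(ltr_rat R) rmorphD /= !fmorph_div /= !rmorph_nat.
have : prob (ratm m) B <= (mass m (bit A))%:R / (total_weight m)%:R.
  by apply: prob_le_mass => i im Bi; rewrite HA// inE.
have : (mass m' (bit J))%:R / (total_weight m')%:R <=
    prob (ratm m') (enlarge B d).
  by apply: mass_le_prob => j jm'; rewrite HJ// inE.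
move: HB ed; set x := _ / _; set y := _ / _; lra.
Qed.

End prokhorov_ratmeasure.

(** * Enumeration in stages *)

(** A stage accepts [k] if some witness below [s] certifies that the program halts on [k]. The
    universal program makes this uniform in [e]; [k < s] makes each stage finite. *)
Lemma re_stages : exists stage : nat -> nat -> nat -> bool,
  [/\ decidable_pred
        (fun z => stage (nleft z) (nleft (nright z)) (nright (nright z))),
      forall e s s' k, (s <= s')%N -> stage e s k -> stage e s' k,
      forall e s k, stage e s k -> (k < s)%N &
      forall P, semidecidable P ->
        exists e, forall k, P k <-> exists s, stage e s k].
Proof.
have U := semidecidable_univ.
have [D DD HD] : semidecidable
    (fun z => exists m, univ (nleft z) (nright z) m).
  by apply/semidecidable_exists/(semidecidable_comp3 U); comp.
exists (fun e s k =>
  (k < s)%N && has (fun i => D (npair (npair e k) i)) (iota 0 s)).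
split=> [|e s s' k ss'|e s k|P /re_semidecidable[c Hc]].
- by comp.
- move=> /andP[ks /hasP[i]]; rewrite mem_iota => is_ Di.
  rewrite (leq_trans ks)//=; apply/hasP; exists i => //.
  by rewrite mem_iota (leq_trans is_).
- by move=> /andP[].
exists (prnum c) => k.
have -> : P k <-> exists m, univ (prnum c) k m.
  have -> : P k = (exists m, pr_eval c k m).
    by rewrite -[RHS]/([set n | exists m, pr_eval c n m] k) -Hc.
  by split=> -[m /univP]; exists m.
have := HD (npair (prnum c) k); rewrite !npairKE => ->.
split=> [[i Di]|[s /andP[_ /hasP[i _ Di]]]]; last by exists i.
exists (maxn k i).+1; rewrite ltnS leq_maxl; apply/hasP; exists i => //.
by rewrite mem_iota /= add0n ltnS leq_maxr.
Qed.

Lemma ratcode_surj q : exists n, ratcode n = q.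
Proof.
have [a [b ab]] : exists a b : nat, numq q = a%:Z - b%:Z.
  by case: (numq q) => n; [exists n, 0%N|exists 0%N, n.+1]; lia.
exists (npair (npair a b) `|denq q|.-1); rewrite /ratcode !npairKE.
rewrite prednK ?absz_gt0// -[RHS]divq_num_den ab rmorphB /=.
by rewrite -[in RHS](gtz0_abs (denq_gt0 q)).
Qed.

Lemma posratcode_inv N : posratcode (npair 0 N) = N.+1%:R^-1.
Proof. by rewrite /posratcode !npairKE mul1r. Qed.

Lemma in_ball_basis (R : realType) (Y : Type) (dist : Y -> Y -> R)
    (alpha : nat -> Y) i j y : dist (alpha i) y < ratr (posratcode j) ->
  ball_basis dist alpha (npair i j) y.
Proof. by rewrite /ball_basis /mkset !npairKE. Qed.

Lemma in_box (R : realType) (Y Z : Type) (U : nat -> set Y) (V : nat -> set Z)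
    i j l y z (r : R) : U i y -> V j z ->
  ratr (ratcode (nleft l)) < r -> r < ratr (ratcode (nright l)) ->
  let n := npair (npair i j) l in
  (U (nleft (nleft n)) `*` V (nright (nleft n)) `*` @rat_interval R (nright n))
    (y, z, r).
Proof.
move=> Uy Vz rl rr n; rewrite /n !npairKE; split; first by split.
by rewrite /rat_interval /mkset rl.
Qed.

(** * Measurability of lower semicomputable functions *)

Section lower_semicomputable.
Context (R : realType) (X : completeMetricType R) (alpha : nat -> X).
Context (Y : Type) (U : nat -> set Y).

(** With [y] and [r] fixed, each box of the enumeration contributes a whole ball or nothing. *)
Lemma lower_semicomputable_open (f : Y -> X -> \bar R) y (r : R) :
  lower_semicomputable U (ball_basis mdist alpha) f ->
  open [set x | (r%:E < f y x)%E].
Proof.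
move=> [W _ HW].
have -> : [set x | (r%:E < f y x)%E] =
    \bigcup_(n in [set n | W n /\ U (nleft (nleft n)) y /\
                           @rat_interval R (nright n) r])
      ball_basis mdist alpha (nright (nleft n)).
  apply/seteqP; split=> x.
    move=> rx; have : [set p : Y * X * R | (p.2%:E < f p.1.1 p.1.2)%E] (y, x,
      r).
      by [].
    by rewrite HW => -[n Wn [[Uy Vx] Ir]]; exists n.
  move=> [n [Wn [Uy Ir]] Vx].
  have : (\bigcup_(n in W) (U (nleft (nleft n)) `*`
     ball_basis mdist alpha (nright (nleft n)) `*` @rat_interval R (nright n)))
     (y, x, r) by exists n.
  by rewrite -HW.
by apply: bigcup_open => n _; exact: open_mdist.
Qed.

Lemma lower_semicomputable_measurable (f : Y -> X -> \bar R) y :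
  lower_semicomputable U (ball_basis mdist alpha) f ->
  measurable_fun [set: borelType X] (f y).
Proof.
move=> lf; apply: (measurability _ (ErealGenOInfty.measurableE R)).
move=> /= _ [_ [r ->]] <-; rewrite setTI preimage_itvoy.
by apply: open_borel; exact: lower_semicomputable_open lf.
Qed.

End lower_semicomputable.

(** * The universal test *)

(* An enumerated number [<<i, j>, k>] stands for the function that takes the
   value [k] on the product of the ball [i] of measures and the ball [j] of
   points, and [0] elsewhere. *)
Definition mcenter (t : nat) : nat := nleft (nleft (nleft t)).
Definition mradius (t : nat) : rat := posratcode (nright (nleft (nleft t))).
Definition center (t : nat) : nat := nleft (nright (nleft t)).
Definition radius (t : nat) : rat := posratcode (nright (nright (nleft t))).
Definition value (t : nat) : nat := nright t.

Definition delta (s : nat) : rat := s.+1%:R^-1.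

Section universal_test.
Context (R : realType) (X : completeMetricType R) (alpha : nat -> X).
Hypothesis hX : computable_metric_space alpha.
Context (stage : nat -> nat -> nat -> bool).
Hypothesis stage_decidable : decidable_pred
  (fun z => stage (nleft z) (nleft (nright z)) (nright (nright z))).
Hypothesis stage_mono : forall e s s' k,
  (s <= s')%N -> stage e s k -> stage e s' k.
Hypothesis stage_lt : forall e s k, stage e s k -> (k < s)%N.

Local Notation M := (probability (borelType X) R).
Implicit Types (mu : M) (x : X).

Local Notation ratm := (ratmeasure alpha).

(** Radii lose four units of [delta s], against three in [bounded_near]: the spare unit absorbs the
    passage from [mu] to an atomic measure and from a point to an atom. *)
Definition inside t s mu x : Prop :=
  prokhorov (ratm (mcenter t)) mu < ratr (mradius t - 4%:R * delta s) /\
  mdist (alpha (center t)) x < ratr (radius t - 4%:R * delta s).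

(* The values at the atoms of the measure [m] of a function that dominates the
   stage [s], with some tolerance, have a mean of at most [1]. *)
Definition bounded_near (e s m : nat) : Prop :=
  exists G, (\sum_(0 <= i < m.+1) weight m i * codenth G i <= total_weight m)%N
    /\
  forall i, (i < m.+1)%N -> forall t, (t < s)%N ->
    ~~ stage e s t \/ (value t <= codenth G i)%N \/
    prokhorov_above alpha (mcenter t) m (mradius t - 3%:R * delta s) \/
    ratr (radius t - 3%:R * delta s) <
      mdist (alpha (center t)) (alpha (atom m i)).

Definition admissible (e : nat) mu (s : nat) : Prop :=
  exists2 m, bounded_near e s m & prokhorov (ratm m) mu < ratr (delta s).

(** A superlevel set of the step function of stage [s], for use in the layer cake formula. *)
Definition level (e : nat) mu (k s : nat) : set X :=
  [set x | exists t, [/\ stage e s t, (k < value t)%N & inside t s mu x]].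

Lemma delta_gt0 s : 0 < ratr (delta s) :> R.
Proof. by rewrite ltr0q invr_gt0. Qed.

Lemma delta_le s s' : (s <= s')%N -> ratr (delta s') <= ratr (delta s) :> R.
Proof. by move=> ss'; rewrite ler_rat lef_pV2 ?posrE ?ltr0n// ler_nat. Qed.

Lemma ratr_radius (r : rat) n s :
  ratr (r - n%:R * delta s) = ratr r - n%:R * ratr (delta s) :> R.
Proof. by rewrite rmorphB rmorphM rmorph_nat. Qed.

Lemma level_mono e mu k s s' : (s <= s')%N ->
  level e mu k s `<=` level e mu k s'.
Proof.
move=> ss' x [t [st kt [mut xt]]]; exists t; split=> //.
  exact: stage_mono st.
have := delta_le ss'; move: mut xt; rewrite /inside !ratr_radius.
by move=> mut xt ds; split; lra.
Qed.

(** A value is at most the number that codes it, which is below [s]. *)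
Lemma level_empty e mu k s : (s <= k)%N -> level e mu k s = set0.
Proof.
move=> sk; apply/seteqP; split=> x // [t [/stage_lt ts kt _]].
have : (value t <= t)%N.
  rewrite -{2}(nunpairK t) /value /npair -ltnS prednK ?muln_gt0 ?expn_gt0//.
  apply: (@leq_trans (1 * (nright t).*2.+1));
    last by rewrite leq_mul// expn_gt0.
  by rewrite mul1n ltnS -addnn leq_addr.
lia.
Qed.

Lemma open_level e mu k s : open (level e mu k s).
Proof.
have -> : level e mu k s = \bigcup_(t in [set t | [/\ stage e s t,
  (k < value t)%N
    & prokhorov (ratm (mcenter t)) mu < ratr (mradius t - 4%:R * delta s)]])
    [set x | mdist (alpha (center t)) x < ratr (radius t - 4%:R * delta s)].
  apply/seteqP; split=> x.
    by move=> [t [st kt [mut xt]]]; exists t.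
  by move=> [t [st kt mut] xt]; exists t.
by apply: bigcup_open => t _; exact: open_mdist.
Qed.

Lemma measurable_level e mu k s : measurable (level e mu k s :
  set (borelType X)).
Proof. exact: (open_borel (@open_level e mu k s)). Qed.

(** Closeness of [mu] to [m] bounds level [k] by the mass of the atoms where [G] exceeds [k], plus
    [delta s]. These masses add up to at most the mean of [G], and at most [s] errors [1 / (s + 1)]
    to at most [1]. *)
Lemma sum_level_le e mu s N : admissible e mu s ->
  \sum_(k < N) prob mu (level e mu k s) <= 2%:R.
Proof.
move=> [m [G [G1 Gs]] mum].
wlog Ns : N / (N <= s)%N.
  move=> H; case: (leqP N s) => [|/ltnW sN]; first exact: H.
  apply: le_trans (H s (leqnn s));
    rewrite -!(big_mkord xpredT (fun k => prob mu (level e mu k s))).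
  rewrite (big_cat_nat (leq0n s) sN)/= [X in _ + X]big_nat_cond.
  rewrite [X in _ + X]big1 ?addr0// => k /andP[/andP[sk _] _].
  by rewrite level_empty// /prob measure0.
have H k : prob mu (level e mu k s) <=
    (mass m (fun i => k < codenth G i)%N)%:R / (total_weight m)%:R + ratr
      (delta s).
  have [_ /prokhorov_close_sym close] := prokhorov_lt mum.
  apply: le_trans (close _ (measurable_level _ _ _ _)) _.
  rewrite lerD2r; apply: prob_le_mass =>
    i im /enlargeP[x [t [st kt [mut xt]]] ix].
  apply: leq_trans kt _.
  (* The atom is within [delta s] of a point of the level, and [m] of [mu], so neither ball can be
     excluded with three units. *)
  have [/negP//|[//|[]]] := Gs i im t (stage_lt st).
    move=> /prokhorov_above_ge; rewrite ratr_radius.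
    have := prokhorov_triangle mu (ratm (mcenter t)) (ratm m).
    rewrite (prokhorov_sym mu); move: mum mut; rewrite /inside ratr_radius.
    lra.
  have := metric_triangle (alpha (center t)) x (alpha (atom m i)).
  by rewrite (metric_sym x); move: xt; rewrite !ratr_radius; lra.
have /le_trans := ler_sum (index_enum 'I_N) (fun (k : 'I_N) (_ : true) => H k).
apply; rewrite big_split /= sumr_const card_ord -mulr_suml.
have d1 : ratr (delta s) *+ N <= 1 :> R.
  rewrite -mulr_natl /delta fmorphV rmorph_nat ler_pdivrMr ?ltr0n// mul1r
    ler_nat.
  exact: leq_trans (leqnSn _).
suff : (\sum_(k < N) (mass m (fun i => k < codenth G i)%N)%:R) /
    (total_weight m)%:R <= 1 :> R by lra.
rewrite ler_pdivrMr ?ltr0n ?total_weight_gt0// mul1r -natr_sum ler_nat.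
apply: leq_trans G1; rewrite /mass exchange_big leq_sum//= => i _.
rewrite -big_distrr leq_mul//=; elim: N {Ns d1} => [|N IH]; rewrite ?big_ord0//.
rewrite big_ord_recr /=; have : (\sum_(k < N) (k < codenth G i) <= N)%N.
  rewrite -[leqRHS]card_ord -sum1_card leq_sum// => k _; exact: leq_b1.
move: IH; set S := (\sum_(k < N) _)%N.
by case: (ltnP N (codenth G i)) => Ng IH SN /=; lia.
Qed.

(** * Trimmed programs and the universal test *)

Definition trimmed_level (e : nat) mu (k : nat) : set X :=
  \bigcup_(s in admissible e mu) level e mu k s.

Lemma open_trimmed_level e mu k : open (trimmed_level e mu k).
Proof. by apply: bigcup_open => s _; exact: open_level. Qed.

Lemma measurable_trimmed_level e mu k :
  measurable (trimmed_level e mu k : set (borelType X)).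
Proof. exact: (open_borel (@open_trimmed_level e mu k)). Qed.

(* The stages increase, so the admissible ones up to a given stage have a
   largest one, which contains the others. *)
Lemma sum_trimmed_level_le e mu N :
  (\sum_(0 <= k < N) mu (trimmed_level e mu k) <= 2%:R%:E)%E.
Proof.
pose F k S := \bigcup_(s in [set s | admissible e mu s /\
  (s <= S)%N]) level e mu k s.
have oF k S : open (F k S) by apply: bigcup_open => s _; exact: open_level.
have mF k S : measurable (F k S : set (borelType X)) by exact:
  (open_borel (oF k S)).
have ndF k : {homo F k : S S' / (S <= S')%N >-> (S <= S')%O}.
  move=> S S' SS'; apply/subsetPset => x [s [sa sS] sx]; exists s => //=.
  by split=> //; exact: leq_trans SS'.
have FU k : \bigcup_S F k S = trimmed_level e mu k.
  apply/seteqP; split=> x; first by move=> [S _ [s [sa _] sx]]; exists s.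
  by move=> [s sa sx]; exists s => //; exists s.
have FS S : (\sum_(0 <= k < N) mu (F k S) <= 2%:R%:E)%E.
  have [[s0 [s0a s0S]]|H] := pselect (exists s, admissible e mu s /\
    (s <= S)%N).
    pose P s := `[< admissible e mu s >] && (s <= S)%N.
    have exP : exists s, P s by exists s0; rewrite /P s0S andbT; exact/asboolP.
    have ubP s : P s -> (s <= S)%N by move=> /andP[].
    case: (ex_maxnP exP ubP) => s /andP[/asboolP sa sS] smax.
    rewrite big_mkord (eq_bigr (fun k : 'I_N => (prob mu (level e mu k s))%:E)).
      by rewrite sumEFin lee_fin; exact: sum_level_le.
    move=> k _; rewrite -probE; last exact: measurable_level.
    congr (mu _); apply/seteqP; split=> x; last by exists s.
    move=> [s' [s'a s'S]]; apply: level_mono; apply: smax.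
    by rewrite /P s'S andbT; exact/asboolP.
  rewrite big1 => [|k _]; first by rewrite lee_fin.
  rewrite (_ : F k S = set0) ?measure0//.
  by apply/seteqP; split=> x // [s sP]; exfalso; apply: H; exists s.
(* Continuity from below passes from the stages up to [S] to all stages. *)
have cvgF k : mu (F k S) @[S --> \oo] --> mu (trimmed_level e mu k).
  rewrite -FU; apply: nondecreasing_cvg_mu => //.
  by rewrite FU; exact: measurable_trimmed_level.
have cvgS : (\sum_(0 <= k < N) mu (F k S))%E @[S --> \oo] -->
    (\sum_(0 <= k < N) mu (trimmed_level e mu k))%E.
  by apply: cvg_nnesum => k _ //; apply: nearW => S.
rewrite -(cvg_lim _ cvgS)//; apply: lime_le; first exact: cvgP cvgS.
exact: nearW.
Qed.

(** Trimmed functions have integral at most [2], so with these weights they contribute at most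
    [1 / 2] in all; the constant of [universal_test] takes the rest. *)
Definition scale (e : nat) : R := (2 ^ e.+3)%:R^-1.

Let scale_ge0 e : 0 <= scale e. Proof. by rewrite invr_ge0. Qed.

Lemma sum_scale_le N : \sum_(0 <= e < N) scale e * 2%:R <= 2^-1.
Proof.
(* Adding the tail of the geometric series gives an identity that induction can prove. *)
suff : \sum_(0 <= e < N) scale e * 2%:R + (2 ^ N.+1)%:R^-1 = 2^-1 :> R.
  by move=> <-; rewrite lerDl invr_ge0.
elim: N => [|N IH]; first by rewrite big_geq// add0r expn1.
rewrite big_nat_recr//= -[RHS]IH -addrA; congr (_ + _).
rewrite /scale !expnS !natrM;
  have : (2 ^ N)%:R != 0 :> R by rewrite pnatr_eq0 expn_eq0.
move: ((2 ^ N)%:R : R) => z z0; by field.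
Qed.

(** In a supremum, unlike a sum, a single witness certifies a lower bound. The constant [1 / 2]
    later absorbs the rounding of [f] to natural numbers. *)
Definition universal_test mu x : \bar R :=
  ereal_sup [set y | y = (2^-1)%:E \/ exists e t s,
    [/\ admissible e mu s, stage e s t, inside t s mu x &
        y = ((value t)%:R * scale e)%:E]].

Lemma universal_test_ge_half mu x : ((2^-1)%:E <= universal_test mu x)%E.
Proof. by apply: ereal_sup_ubound; left. Qed.

(** The levels decrease in [k], so this count is the supremum of the values at [x] over the
    admissible stages. *)
Let layers e mu x : \bar R :=
  (\sum_(0 <= k <oo) (\1_(trimmed_level e mu k) x)%:E)%E.

Let measurable_layer e mu k : measurable_fun [set: borelType X]
  (fun x => (\1_(trimmed_level e mu k) x)%:E : \bar R).
Proof.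
apply/measurable_EFinP/measurable_indic.
exact: measurable_trimmed_level.
Qed.

Let layer_ge0 e mu k x : (0 <= (\1_(trimmed_level e mu k) x)%:E :> \bar R)%E.
Proof. by rewrite lee_fin indicE. Qed.

Let layers_ge0 e mu x : (0 <= layers e mu x)%E.
Proof. exact: nneseries_ge0. Qed.

Let measurable_layers e mu : measurable_fun [set: borelType X] (layers e mu).
Proof. exact: ge0_emeasurable_sum. Qed.

Let integral_layers e mu : (\int[mu]_x layers e mu x <= 2%:R%:E)%E.
Proof.
rewrite integral_nneseries//; apply: lime_le.
  by apply: is_cvg_nneseries => k _ _; exact: integral_ge0.
apply: nearW => N; apply: le_trans (sum_trimmed_level_le e mu N).
apply: lee_sum => k _; rewrite integral_indic//; last first.
  exact: measurable_trimmed_level.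
by rewrite setIT.
Qed.

(** A value [v] at [x] puts [x] in levels [0] to [v - 1], so the layers dominate it; the supremum
    over programs is bounded by the sum. *)
Lemma universal_test_le mu x : (universal_test mu x <=
  (2^-1)%:E + \sum_(0 <= e <oo) (scale e)%:E * layers e mu x)%E.
Proof.
have S0 e : (0 <= (scale e)%:E * layers e mu x)%E by rewrite mule_ge0// lee_fin.
apply: ge_ereal_sup => _ [->|[e [t [s [sa st tx ->]]]]].
  by rewrite leeDl// nneseries_ge0.
apply: (@le_trans _ _ ((scale e)%:E * layers e mu x)%E).
  rewrite mulrC EFinM lee_wpmul2l ?lee_fin//.
  apply: (@le_trans _ _ (\sum_(0 <= k < value t) (\1_(trimmed_level e mu k)
    x)%:E)%E).
    rewrite big_nat_cond (eq_bigr (fun=> 1%E)) => [|k /andP[/andP[_ kt] _]].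
      by rewrite -big_nat_cond sumEFin lee_fin big_mkord sumr_const card_ord.
    by rewrite indicE mem_set//; exists s => //; exists t.
  exact: nneseries_lim_ge.
apply: (@le_trans _ _ (\sum_(0 <= i < e.+1) (scale i)%:E * layers i mu x)%E).
  by rewrite big_nat_recr//= leeDr// sume_ge0.
apply: le_trans (nneseries_lim_ge _ _) _ => //.
by rewrite leeDr// lee_fin.
Qed.

(** Boxes on which the test is at least [q], the upper end of the interval. By the triangle
    inequality, subtracting the radii [mr] and [r] makes the conditions hold throughout the box. *)
Definition universal_box (w : nat) : Prop :=
  let mc := nleft (nleft (nleft w)) in
  let mr := posratcode (nright (nleft (nleft w))) in
  let c := nleft (nright (nleft w)) in
  let r := posratcode (nright (nright (nleft w))) in
  let q := ratcode (nright (nright w)) in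
  q <= 2%:R^-1 \/ exists e, exists s, exists m, exists t,
    [/\ bounded_near e s m, stage e s t,
        prokhorov_below alpha mc m (delta s - mr),
        prokhorov_below alpha mc (mcenter t) (mradius t - 4%:R * delta s - mr) &
        mdist (alpha (center t)) (alpha c) <
          ratr (radius t - 4%:R * delta s - r) /\
        q <= (value t)%:R * (2 ^ e.+3)%:R^-1].

Let dist_lt := semidecidable_dist_lt hX.
Let dist_gt := semidecidable_dist_gt hX.
Let below := semidecidable_prokhorov_below hX.
Let above := semidecidable_prokhorov_above hX.
Hint Resolve dist_lt dist_gt below above : comp.

Let decidable_stage a b c : computable a -> computable b -> computable c ->
  decidable_pred (fun n => stage (a n) (b n) (c n)).
Proof.
move=> Ca Cb Cc.
apply: (@decidable_ext (fun n => let z := npair (a n) (npair (b n) (c n)) in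
  stage (nleft z) (nleft (nright z)) (nright (nright z)))) => [n /=|].
  by rewrite !npairKE.
by apply: (decidable_comp stage_decidable); comp.
Qed.
Hint Resolve decidable_stage : comp.

Lemma semidecidable_bounded_near :
  semidecidable (fun z => bounded_near (nleft z) (nleft (nright z)) (nright
    (nright z))).
Proof.
rewrite /bounded_near /mcenter /mradius /center /radius /value /delta; comp.
Qed.

Lemma semidecidable_universal_box : semidecidable universal_box.
Proof.
have B a b c : computable a -> computable b -> computable c ->
    semidecidable (fun n => bounded_near (a n) (b n) (c n)).
  by move=> *; apply: (semidecidable_comp3 semidecidable_bounded_near); comp.
apply: (@semidecidable_ext (fun w =>
  ratcode (nright (nright w)) <= 2%:R^-1 \/ exists e, exists s, exists m,
    exists t,
    bounded_near e s m /\ stage e s t /\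
    prokhorov_below alpha (nleft (nleft (nleft w))) m
      (delta s - posratcode (nright (nleft (nleft w)))) /\
    prokhorov_below alpha (nleft (nleft (nleft w))) (mcenter t)
      (mradius t - 4%:R * delta s - posratcode (nright (nleft (nleft w)))) /\
    mdist (alpha (center t)) (alpha (nleft (nright (nleft w)))) <
      ratr (radius t - 4%:R * delta s - posratcode (nright (nright (nleft w))))
        /\
    ratcode (nright (nright w)) <= (value t)%:R * (2 ^ e.+3)%:R^-1)) => [w|].
  split=> -[?|[e [s [m [t]]]]]; [by left| |by left|].
    by move=> [? [? [? [? [? ?]]]]]; right; exists e, s, m, t.
  by move=> [? ? ? ? [? ?]]; right; exists e, s, m, t.
rewrite /mcenter /mradius /center /radius /value /delta; comp.
Qed.

Lemma ratr_scale e k : ratr (k%:R * (2 ^ e.+3)%:R^-1) = k%:R * scale e :> R.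
Proof. by rewrite rmorphM fmorphV !rmorph_nat. Qed.

(** The conditions on [mu] and [x] are strict, so they leave a gap, and a small box around nearby
    centers still satisfies them. *)
Lemma lower_semicomputable_universal_test :
  lower_semicomputable (ball_basis (@prokhorov R X) ratm)
    (ball_basis mdist alpha) universal_test.
Proof.
exists [set w | universal_box w].
  exact: re_semidecidable semidecidable_universal_box.
have [da _] := hX.
have near_alpha x (d : R) : 0 < d -> exists v, mdist (alpha v) x < d.
  move=> d0; have [||y [/= xy [v _ vy]]] := da [set y | mdist x y < d].
  - by exists x; rewrite /= mdistxx.
  - exact: open_mdist.
  by exists v; rewrite vy metric_sym.
have ratrB (a b : rat) : ratr (a - b) = ratr a - ratr b :> R by rewrite rmorphB.
(* The radius [u] is paid twice: for the distance to the new center and for the radius of the new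
   ball. *)
have half_gap (u gap a p q d : R) :
    u < gap / 2%:R -> gap <= a - p -> q < u -> d <= q + p -> d < a - u by lra.
have center_gap (a b p q d : R) :
    p <= a - b -> q < b -> d <= p + q -> d < a by lra.
have exists_le3 (a b c : R) : 0 < a -> 0 < b -> 0 < c ->
    exists2 d : R, 0 < d & [/\ d <= a, d <= b & d <= c].
  move=> a0 b0 c0; exists (Num.min a (Num.min b c));
    first by rewrite !lt_min a0 b0.
  by split; rewrite !ge_min lexx ?orbT.
have rat_box (r y : R) : r < y -> exists2 l, ratr (ratcode (nleft l)) < r &
    r < ratr (ratcode (nright l)) /\ ratr (ratcode (nright l)) < y.
  move=> ry; have [q] := rat_in_itvoo ry; rewrite in_itv /= => /andP[rq qy].
  have [p] : exists p, ratr p \in `](r - 1), r[ by apply: rat_in_itvoo; lra.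
  rewrite in_itv /= => /andP[_ pr].
  have [a ap] := ratcode_surj p; have [b bq] := ratcode_surj q.
  by exists (npair a b); rewrite ?npairKE ?ap ?bq.
apply/seteqP; split=> [[[mu x] r] /= /ereal_sup_gt[y [->|]]|].
(* Below [1 / 2] the box only has to contain the point; the ball of measures has radius [2], and all
   distances are at most [1]. *)
- rewrite lte_fin => /rat_box[l pr [rq qh]].
  have [v vx] := near_alpha x 1 ltr01.
  exists (npair (npair (npair 0 (npair 1 0)) (npair v (npair 0 0))) l).
    left; rewrite !npairKE -(ler_rat R) fmorphV rmorph_nat; exact: ltW.
  apply: in_box => //; apply: in_ball_basis; rewrite /posratcode !npairKE divr1.
    by rewrite rmorph_nat (le_lt_trans (prokhorov_le1 _ _))// ltr1n.
  by rewrite rmorph1.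
- move=> [e [t [s [[m Bm mum] st [mut xt] ->]]]].
  rewrite lte_fin => /rat_box[l pr [rq qy]].
  have [gap gap0 [g1 g2 g3]] : exists2 gap : R, 0 < gap & [/\
      gap <= ratr (delta s) - prokhorov (ratm m) mu,
      gap <= ratr (mradius t - 4%:R * delta s) - prokhorov (ratm (mcenter t))
        mu &
      gap <= ratr (radius t - 4%:R * delta s) - mdist (alpha (center t)) x].
    by apply: exists_le3; rewrite subr_gt0.
  have [N /(_ N (leqnn N)) HN] := invS_small (divr_gt0 gap0 (ltr0Sn R 1)).
  have rN : ratr (posratcode (npair 0 N)) = N.+1%:R^-1 :> R.
    by rewrite posratcode_inv fmorphV rmorph_nat.
  have N0 : 0 < N.+1%:R^-1 :> R by rewrite invr_gt0.
  have [i im] := @ratmeasure_dense _ _ alpha mu _ da N0.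
  have [j jx] := near_alpha x _ N0.
  exists (npair (npair (npair i (npair 0 N)) (npair j (npair 0 N))) l).
    right; exists e, s, m, t; rewrite !npairKE; split => //.
    + apply: prokhorov_lt_below; rewrite ratrB rN.
      apply: (half_gap _ _ _ _ _ _ HN g1 im); rewrite (prokhorov_sym (ratm m)).
      exact: prokhorov_triangle.
    + apply: prokhorov_lt_below; rewrite ratrB rN.
      apply: (half_gap _ _ _ _ _ _ HN g2 im);
        rewrite (prokhorov_sym (ratm (mcenter t))).
      exact: prokhorov_triangle.
    + split.
        rewrite ratrB rN; apply: (half_gap _ _ _ _ _ _ HN g3 jx).
        rewrite (metric_sym (alpha j)) addrC; exact: metric_triangle.
      by rewrite -(ler_rat R) ratr_scale ltW.
  by apply: in_box => //; apply: in_ball_basis; rewrite rN.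
move=> [[mu x] r] [w wbox [[/= muw xw]]].
rewrite /rat_interval /= => /andP[_ rq].
apply: (@lt_le_trans _ _ (ratr (ratcode (nright (nright w))))%:E).
  by rewrite lte_fin.
case: wbox => [qh|[e [s [m [t [Bm st]]]]]].
  apply: le_trans (universal_test_ge_half mu x).
  by rewrite lee_fin -(ler_rat R) fmorphV rmorph_nat in qh *.
move=> /prokhorov_below_le + /prokhorov_below_le + [].
move: muw xw; rewrite /ball_basis /=.
set mr := posratcode _; set r' := posratcode _ => muw xw.
rewrite ratrB => wm; rewrite ratrB => wt; rewrite ratrB => wc qt.
apply: (@le_trans _ _ ((value t)%:R * scale e)%:E).
  by rewrite lee_fin -ratr_scale ler_rat.
apply: ereal_sup_ubound; right; exists e, t, s; split => //.
  exists m => //; apply: (center_gap _ _ _ _ _ wm muw).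
  rewrite (prokhorov_sym (ratm _) (ratm m)); exact: prokhorov_triangle.
split.
  apply: (center_gap _ _ _ _ _ wt muw).
  rewrite (prokhorov_sym (ratm _) (ratm (mcenter t)));
    exact: prokhorov_triangle.
apply: (center_gap _ _ _ _ _ (ltW wc) xw); exact: metric_triangle.
Qed.

(** The constant and the weighted layers contribute at most [1 / 2] each. *)
Lemma integral_universal_test mu : (\int[mu]_x universal_test mu x <= 1)%E.
Proof.
have mt : measurable_fun [set: borelType X] (universal_test mu).
  exact: lower_semicomputable_measurable lower_semicomputable_universal_test.
have t0 x : (0 <= universal_test mu x)%E.
  by apply: le_trans (universal_test_ge_half mu x); rewrite lee_fin.
have ml e : measurable_fun [set: borelType X]
    (fun x => (scale e)%:E * layers e mu x)%E.
  exact: measurable_funeM.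
have l0 e x : (0 <= (scale e)%:E * layers e mu x)%E by rewrite mule_ge0//
  lee_fin.
apply: (@le_trans _ _ (\int[mu]_(x in [set: borelType X])
    ((2^-1)%:E + \sum_(0 <= e <oo) (scale e)%:E * layers e mu x))%E).
  apply: ge0_le_integral => //.
  - apply: emeasurable_funD => //; exact: ge0_emeasurable_sum.
  - by move=> x _; exact: universal_test_le.
rewrite ge0_integralD//; last 2 first.
- by move=> x _; exact: nneseries_ge0.
- exact: ge0_emeasurable_sum.
rewrite integral_cst// [X in (_ * X + _ <= _)%E](_ : _ = 1%E); last first.
  exact: probability_setT.
rewrite mule1 integral_nneseries//.
have -> : 1%E = ((2^-1)%:E + (2^-1)%:E)%E :> \bar R by rewrite -EFinD;
  congr EFin; lra.
apply: leeD => //; apply: lime_le.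
  by apply: is_cvg_nneseries => e _ _; exact: integral_ge0.
apply: nearW => N; apply: le_trans (_ :
  (\sum_(0 <= e < N) scale e * 2%:R)%:E <= _)%E.
  rewrite -sumEFin lee_sum// => e _.
  rewrite ge0_integralZl ?lee_fin// EFinM.
  by apply: lee_wpmul2l (integral_layers e mu); rewrite lee_fin.
by rewrite lee_fin sum_scale_le.
Qed.

Lemma randomness_test_universal_test : randomness_test alpha universal_test.
Proof.
split=> [mu x| |mu].
- by apply: le_trans (universal_test_ge_half mu x); rewrite lee_fin.
- exact: lower_semicomputable_universal_test.
- exact: integral_universal_test.
Qed.

(** * Domination of all tests *)

Definition enumerates_below (e : nat) (f : M -> X -> \bar R) : Prop :=
  forall s t mu x, stage e s t ->
    prokhorov (ratm (mcenter t)) mu < ratr (mradius t) ->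
    mdist (alpha (center t)) x < ratr (radius t) ->
    ((value t)%:R%:E < f mu x)%E.

(** With [enumerates_below]: the values enumerated at a point are exactly the natural numbers
    strictly below [f]. *)
Definition enumerates_above (e : nat) (f : M -> X -> \bar R) : Prop :=
  forall mu x k, (k%:R%:E < f mu x)%E -> exists s t,
    [/\ stage e s t, prokhorov (ratm (mcenter t)) mu < ratr (mradius t),
        mdist (alpha (center t)) x < ratr (radius t) & value t = k].

(** A ball that does not recognizably exclude the atom when reduced by three units contains it at
    full radius, so its value lies below [f] there. The test inequality at [ratm m] bounds the
    mean. *)
Lemma bounded_near_test f e s m : randomness_test alpha f ->
  enumerates_below e f -> bounded_near e s m.
Proof.
move=> [f0 lf f1] fe.
pose P i t := [/\ stage e s t,
  ~ prokhorov_above alpha (mcenter t) m (mradius t - 3%:R * delta s) &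
  ~ ratr (radius t - 3%:R * delta s) <
    mdist (alpha (center t)) (alpha (atom m i))].
(* The least possible [G]: the maximum of the values not excluded, [0] if there are none. *)
pose g i := (\max_(t < s | `[< P i t >]) value t)%N.
have gf i : ((g i)%:R%:E <= f (ratm m) (alpha (atom m i)))%E.
  rewrite /g; elim/big_ind: _ => [|a b Ha Hb|t /asboolP[st Nm Nc]].
  - exact: f0.
  - by rewrite /maxn; case: ifP.
  have ds := delta_gt0 s; apply/ltW/(fe _ _ _ _ st).
    move: Nm; rewrite ltNge; apply: contra_notN => Nm.
    apply: prokhorov_gt_above; apply: lt_le_trans Nm.
    rewrite ratr_radius; move: ds; set a := ratr (delta s); lra.
  move/negP: Nc; rewrite -leNgt ratr_radius.
  move: ds; set a := ratr (delta s); lra.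
exists (CodeSeq.code (mkseq g m.+1)); split.
  have mf : measurable_fun [set: borelType X] (f (ratm m)).
    exact: lower_semicomputable_measurable lf.
  have := f1 (ratm m); rewrite (integral_ratmeasure alpha m mf (f0 _)).
  set S := (\sum_(0 <= i < m.+1) _)%E => S1.
  have : ((\sum_(0 <= i < m.+1) weight m i * g i)%N%:R%:E <= S)%E.
    rewrite natr_sum -sumEFin lee_sum// => i _.
    by rewrite natrM EFinM lee_wpmul2l ?lee_fin.
  have N0 : 0 < (total_weight m)%:R :> R by rewrite ltr0n total_weight_gt0.
  have : (S <= (total_weight m)%:R%:E)%E.
    have -> : S = ((total_weight m)%:R%:E * ((total_weight m)%:R^-1%:E * S))%E.
      by rewrite muleA -EFinM mulfV ?lt0r_neq0// mul1e.
    by rewrite -[leRHS]mule1 lee_wpmul2l// lee_fin ltW.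
  move=> /[swap] /le_trans /[apply]; rewrite lee_fin ler_nat; apply: leq_trans.
  rewrite !big_mkord leq_sum// => i _.
  by rewrite codenthE CodeSeq.codeK nth_mkseq.
move=> i im t ts; case: (boolP (stage e s t)) => st; [right|by left].
have [Nm|Nm] := pselect (prokhorov_above alpha (mcenter t) m
  (mradius t - 3%:R * delta s)); first by right; left.
case: (ltP (ratr (radius t - 3%:R * delta s))
  (mdist (alpha (center t)) (alpha (atom m i)))) => Nc; first by right; right.
left; rewrite codenthE CodeSeq.codeK nth_mkseq//.
apply: (@leq_bigmax_cond _ (fun t : 'I_s => `[< P i t >]) (fun t => value t)
  (Ordinal ts)).
by apply/asboolP; split => //; apply/negP; rewrite -leNgt.
Qed.

(** At a late stage, four units of [delta s] fit in the gap left by the strict inequalities; the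
    stage is admissible because [f] is a test. *)
Lemma le_universal_test f e mu x k : randomness_test alpha f ->
  enumerates_below e f -> enumerates_above e f ->
  (k%:R%:E < f mu x)%E -> ((k%:R * scale e)%:E <= universal_test mu x)%E.
Proof.
move=> tf fe ef /ef[s0 [t [st mut xt <-]]].
have [gap gap0 [g1 g2]] : exists2 gap : R, 0 < gap &
    gap <= ratr (mradius t) - prokhorov (ratm (mcenter t)) mu /\
    gap <= ratr (radius t) - mdist (alpha (center t)) x.
  exists (Num.min (ratr (mradius t) - prokhorov (ratm (mcenter t)) mu)
    (ratr (radius t) - mdist (alpha (center t)) x)).
    by rewrite lt_min !subr_gt0 mut.
  by split; rewrite ge_min lexx ?orbT.
have [N HN] := invS_small (divr_gt0 gap0 (ltr0Sn R 3)).
pose s := maxn s0 N.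
have ds : ratr (delta s) < gap / 4%:R :> R.
  by rewrite fmorphV rmorph_nat; apply: HN; exact: leq_maxr.
have four (a b d : R) : gap <= a - b -> d < gap / 4%:R ->
  b < a - 4%:R * d by lra.
have [m mum] := ratmeasure_dense mu (proj1 hX) (delta_gt0 s).
apply: ereal_sup_ubound; right; exists e, t, s; split => //.
- by exists m => //; exact: bounded_near_test tf fe.
- by apply: stage_mono st; exact: leq_maxl.
- by rewrite /inside !ratr_radius; split; exact: four.
Qed.

(** If [k < f <= k + 1], then [f * scale e / 2] is at most the mean of [k * scale e] and [scale e].
    The test dominates both, the second through its constant [1 / 2]. *)
Lemma universal_test_dominates f e : randomness_test alpha f ->
  enumerates_below e f -> enumerates_above e f ->
  forall mu x, ((2%:R^-1 * scale e)%:E * f mu x <= universal_test mu x)%E.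
Proof.
move=> tf fe ef mu x; have [f0 _ _] := tf.
have scale_gt0 : 0 < scale e by rewrite invr_gt0 ltr0n expn_gt0.
have scale_le : scale e <= 2^-1.
  rewrite lef_pV2 ?posrE ?ltr0n ?expn_gt0// ler_nat expnS.
  by rewrite -[leqLHS]muln1 leq_mul// expn_gt0.
have half := universal_test_ge_half mu x.
have H k := le_universal_test (k := k) tf fe ef (mu := mu) (x := x).
move: H half (f0 mu x); case: (f mu x) => [r| |] // H half r0; last first.
  (* Where [f] is infinite, the test is above all multiples of [scale e]. *)
  suff -> : universal_test mu x = +oo%E by rewrite leey.
  apply/eqP; rewrite eq_le leey /= leNgt; apply/negP => tfin.
  have := half; move: tfin H; case: (universal_test mu x) => [y| |] // _ H _.
  have := H (Num.truncn (y / scale e)).+1 (ltry _).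
  by rewrite lee_fin -ler_pdivlMr// leNgt truncnS_gt.
(* Positivity gives [k < r] in the case [k = 0]. *)
have [->|rpos] : r = 0 \/ 0 < r.
  by move: r0; rewrite lee_fin le_eqVlt => /orP[/eqP <-|]; [left|right].
  by rewrite mule0 (le_trans _ half)// lee_fin.
have exk : exists k : nat, r <= k.+1%:R.
  by exists (Num.truncn r); apply/ltW/truncnS_gt.
case: (ex_minnP exk) => k rk kmin.
have kr : k%:R < r.
  case: k rk kmin => [//|k] rk kmin; rewrite ltNge; apply/negP => /kmin.
  by rewrite ltnn.
have := H k; rewrite lte_fin => /(_ kr) Hk.
move: half Hk; case: (universal_test mu x) => [y| |] //; rewrite ?leey//.
rewrite -EFinM !lee_fin => half Hk.
have : 2^-1 * scale e * r <= 2^-1 * scale e * k.+1%:R.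
  by rewrite ler_wpM2l// mulr_ge0// ltW.
have -> : 2^-1 * scale e * k.+1%:R = 2^-1 * (k%:R * scale e) + 2^-1 * scale e.
  by rewrite -[k.+1%:R]natr1; ring.
move: scale_le Hk half; set u := k%:R * _; set v := scale e.
set w := 2^-1 * v * r; lra.
Qed.

End universal_test.

Theorem theorem3p2 (R : realType) (X : completeMetricType R) (alpha : nat -> X)
    (hX : computable_metric_space alpha)
    (hB : recognizable_Boolean_inclusions alpha) :
  exists2 t : probability (borelType X) R -> X -> \bar R,
    randomness_test alpha t &
    forall f : probability (borelType X) R -> X -> \bar R,
      randomness_test alpha f ->
      exists2 c : R, 0 < c & forall mu x, (c%:E * f mu x <= t mu x)%E.
Proof.
have [stage [dec mono lt enum]] := re_stages.
exists (universal_test alpha stage).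
  exact: randomness_test_universal_test.
move=> f tf; have [f0 [W reW HW] _] := tf; have sW := semidecidable_re reW.
(* A box of [W] whose interval contains the natural number [k] becomes the step function with value
   [k] on its two balls. *)
pose P t := exists l, W (npair (nleft t) l) /\
  ratcode (nleft l) < (nright t)%:R /\ (nright t)%:R < ratcode (nright l).
have SP : semidecidable P.
  have sWc g : computable g -> semidecidable (fun n => W (g n)).
    by move=> Cg; exact: (semidecidable_comp sW).
  by rewrite /P; comp.
have [e He] := enum P SP.
have below : enumerates_below alpha stage e f.
  move=> s t mu x st mut xt.
  have [l [Wl [l1 l2]]] : P t by apply/He; exists s.
  have := @in_box R _ _ (ball_basis (@prokhorov R X) (ratmeasure alpha))
    (ball_basis mdist alpha) (nleft (nleft t)) (nright (nleft t)) l mu x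
    (nright t)%:R mut xt.
  rewrite -(rmorph_nat (ratr : rat -> R)) !ltr_rat !nunpairK =>
    /(_ l1 l2) /= box.
  have : (\bigcup_(n in W) (ball_basis (@prokhorov R X) (ratmeasure alpha)
      (nleft (nleft n)) `*` ball_basis mdist alpha (nright (nleft n)) `*`
      @rat_interval R (nright n))) (mu, x, ratr (nright t)%:R).
    by exists (npair (nleft t) l).
  by rewrite -HW /= rmorph_nat.
have above : enumerates_above alpha stage e f.
  move=> mu x k kf.
  have : [set p : probability (borelType X) R * X * R |
    (p.2%:E < f p.1.1 p.1.2)%E] (mu, x, k%:R) by [].
  rewrite HW => -[n Wn [[mun xn]]]; rewrite /rat_interval /= => /andP[n1 n2].
  have [s st] : exists s, stage e s (npair (nleft n) k).
    apply/He; exists (nright n); rewrite !npairKE nunpairK; split=> //.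
    by rewrite -!(ltr_rat R) rmorph_nat.
  exists s, (npair (nleft n) k);
    rewrite /mcenter /mradius /center /radius /value.
  by rewrite !npairKE.
exists (2%:R^-1 * scale R e).
  by rewrite mulr_gt0 ?invr_gt0// ltr0n expn_gt0.
exact: universal_test_dominates.
Qed.
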